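(* Let $p$ be a real polynomial of degree $m$. For each $n$ let $J_n$ be a random real symmetric tridiagonal $n\times n$ matrix with independent entries as described in the context, and let $$S_n=\operatorname{Tr}(p(J_n))=\sum_{j=1}^n p(J_n)(j,j).$$ Assume that there exists a sequence of positive numbers $\{v_n\}$ such that (i) $v_n^2\operatorname{Var}[S_n]\to\sigma_p^2$ as $n\to\infty$, where $\sigma_p^2\ge0$ is a constant; and (ii) $v_n^4\,\mathbf{E}[\Delta_k(\xi_w)^4]\le \dfrac{C}{n^{1+\delta}}$ for all admissible paths $w\in\mathcal{Q}_m(n)$ and all $k=1,\dots,n$, where $C>0$ and $\delta>0$ are constants not depending on $n$. Then, as $n\to\infty$, $$v_n(S_n-\mathbf{E}[S_n])\to\mathcal{N}(0,\sigma_p^2)\quad\text{in distribution.}$$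
   Context: For each $n$, $J_n$ is the symmetric tridiagonal (Jacobi) matrix with diagonal entries $J_n(i,i)=a_i=a_i^{(n)}\in\mathbb{R}$ ($1\le i\le n$) and off-diagonal entries $J_n(i,i+1)=J_n(i+1,i)=b_i=b_i^{(n)}>0$ ($1\le i\le n-1$), where for each $n$ the random variables $a_1,\dots,a_n,b_1,\dots,b_{n-1}$ are independent (not necessarily identically distributed). An admissible path of length $r$ (for given $n$) is a closed path $w=(i_0,i_1,\dots,i_r)$ with $i_r=i_0$, $|i_{l+1}-i_l|\le1$ for $0\le l\le r-1$, and all $i_l\in\{1,\dots,n\}$. $\mathcal{Q}_m(n)$ is the set of all admissible paths of length at most $m$. For an admissible path $w$, $$\xi_w=\prod_{l=0}^{r-1}J_n(i_l,i_{l+1}).$$ The filtration is $\mathcal{F}_0=\{\emptyset,\Omega\}$, $\mathcal{F}_k=\sigma(a_i,b_i:i=1,\dots,k)$ for $1\le k\le n$ (with $b_n$ absent when $k=n$), and $$\Delta_k(\xi_w)=\mathbf{E}[\xi_w|\mathcal{F}_k]-\mathbf{E}[\xi_w|\mathcal{F}_{k-1}].$$ It is assumed that $\xi_w$ is integrable for every $w\in\mathcal{Q}_m(n)$, so that these conditional expectations are defined. $\mathcal{N}(0,\sigma^2)$ is the centered Gaussian distribution with variance $\sigma^2$ ($\mathcal{N}(0,0)$ being the point mass at $0$). *)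

(* Defs.v *)
From HB Require Import structures.
From mathcomp Require Export all_boot all_order all_algebra.
From mathcomp Require Export all_classical all_reals all_analysis.
Export numFieldNormedType.Exports.

Set Implicit Arguments.
Unset Strict Implicit.
Unset Printing Implicit Defensive.

Import Order.TTheory GRing.Theory Num.Theory.
Local Open Scope classical_set_scope.
Local Open Scope ring_scope.

Section Probability.
Context {d : measure_display} {T : measurableType d} {R : realType}.
Variable P : probability T R.

Definition mutually_independent {I : finType} (X : I -> {RV P >-> R}) :=
  forall (D : {set I}) (B : I -> set R),
    (forall i, measurable (B i)) ->
    P (\bigcap_(i in [set` D]) (X i @^-1` B i)) =
    (\prod_(i in D) fine (P (X i @^-1` B i)))%:E.

(* Y is a version of E[X | G], where G is a sub-sigma-algebra of T. *)
Definition is_condexp (G : set (set T)) (X Y : T -> R) :=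
  [/\ g_sigma_algebra_preimage Y `<=` G,
      P.-integrable setT (EFin \o Y) &
      forall A, G A ->
        (\int[P]_(w in A) (Y w)%:E = \int[P]_(w in A) (X w)%:E)%E].

(* A chosen version; for integrable X a version exists and any two agree
   P-almost everywhere. *)
Definition condexp (G : set (set T)) (X : T -> R) : T -> R :=
  xget (cst 0) [set Y | is_condexp G X Y].

End Probability.

(* Convergence of the distribution functions at every continuity point of the
   limit law; the X n may live on different probability spaces. *)
Definition cvg_in_distribution (R : realType) (d : nat -> measure_display)
    (T : forall n, measurableType (d n)) (P : forall n, probability (T n) R)
    (X : forall n, T n -> R) (mu : probability (measurableTypeR R) R) :=
  forall x : R, {for x, continuous (fun y : R => mu [set` `]-oo, y]])} ->
    P n (X n @^-1` [set` `]-oo, x]]) @[n --> \oo] --> mu [set` `]-oo, x]].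

(* The library's normal_prob takes a standard deviation and is not a point mass
   when that deviation is zero. *)
Definition centered_gaussian (R : realType) (var : R) :
    probability (measurableTypeR R) R :=
  if var == 0 then [the probability _ _ of @dirac _ (measurableTypeR R) 0 R]
  else [the probability _ _ of normal_prob 0 (Num.sqrt var)].

(* A path (i_0, i_1, ..., i_r) is encoded as the pair (i_0, [:: i_1; ...; i_r]),
   so that its length r is the size of the second component. *)
Definition adjacent N (i j : 'I_N) : bool := (i <= j.+1)%N && (j <= i.+1)%N.

Definition admissible_paths m N : set ('I_N * seq 'I_N) :=
  [set w | [/\ path (@adjacent N) w.1 w.2, last w.1 w.2 = w.1
             & (size w.2 <= m)%N]].

Definition path_weight (R : realType) N (J : 'M[R]_N) (w : 'I_N * seq 'I_N) : R :=
  \prod_(e <- zip (w.1 :: w.2) w.2) J e.1 e.2.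

Section Jacobi.
Context {d : measure_display} {T : measurableType d} {R : realType}.
Context {P : probability T R}.
(* Indices start at 0: for the N x N matrix only a 0, ..., a (N - 1) and
   b 0, ..., b (N - 2) are used. *)
Variables (N : nat) (a b : nat -> {RV P >-> R}).

Definition jacobi (w : T) : 'M[R]_N :=
  \matrix_(i < N, j < N)
    if j == i then a i w
    else if j == i.+1 :> nat then b i w
    else if i == j.+1 :> nat then b j w
    else 0.

Definition entries (x : 'I_N + 'I_N.-1) : {RV P >-> R} :=
  match x with inl i => a i | inr i => b i end.

Definition filtration (k : nat) : set (set T) :=
  <<s \bigcup_(i in `I_k) g_sigma_algebra_preimage (a i) `|`
      \bigcup_(i in `I_(minn k N.-1)) g_sigma_algebra_preimage (b i) >>.

Definition mdiff (k : nat) (X : T -> R) : T -> R :=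
  condexp P (filtration k) X \- condexp P (filtration k.-1) X.

End Jacobi.

(* Main.v *)
From HB Require Import structures.
Require Import Defs.
From mathcomp Require Import measurable_realfun ring lra zify.

Set Implicit Arguments.
Unset Strict Implicit.
Unset Printing Implicit Defensive.
Import Order.TTheory GRing.Theory Num.Theory.
Local Open Scope classical_set_scope.
Local Open Scope ring_scope.

(** Call site [k] the pair of the [k]-th diagonal entry and of the entry that
    links [k] to [k + 1]. The trace of [p(J_n)] is a combination of the weights
    of closed paths, and a path weight is a product over sites of independent
    factors. Its conditional expectation given the first [k] sites is the product
    of the first [k] factors and of the means of the others, so its martingale
    difference at [k] vanishes unless the path touches site [k], and otherwise
    depends only on boundedly many sites just before [k]
    ([martingale_decomposition]).

    Summing over paths, [v_n (S_n - E S_n)] is almost surely a sum of martingale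
    differences [X_k] that are also locally dependent: [X_k] is independent of
    all the [X_j] with [|j - k|] large ([trace_locally_dependent]). Only boundedly
    many paths contribute to each [X_k], so that [E X_k^4] is at most a constant
    times [1 / n^(1 + delta)], uniformly in [k], and the fourth moments add up to
    [O(n^(-delta))]. The variables are orthogonal, so their second moments add up
    to the variance, which converges.

    Local dependence makes Stein's method available, and this replaces both the
    martingale central limit theorem and characteristic functions. Let [W] be the
    sum of the [X_k], let [W_k] be the sum of the [X_j] with [j] close to [k], and
    take [f] with bounded Lipschitz derivative. Then [X_k] is independent of
    [W - W_k] and centered, so
    [E (W f(W)) = sum_k E (X_k (f(W) - f(W - W_k)))], which is
    [sum_k E (X_k W_k f'(W))] up to an error of order [sum_k E (|X_k| W_k^2)].
    The sum of the [X_k W_k] has the variance of [W] as its mean, and it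
    concentrates because products at distant sites are independent. All errors
    are controlled by second and fourth moments ([stein_bound]).

    For a piecewise linear step [h] (a [ramp]) with Gaussian mean [c], the equation
    [s^2 f' - x f = h - c] has a solution with bounded Lipschitz derivative, by
    Mills ratio bounds on Gaussian tails ([stein_equation]). Therefore [E h(W)]
    tends to [c], and ramps squeeze the indicators of half-lines
    ([cvg_in_distribution_ramp]). If the limiting variance is zero, [W] tends to
    [0] in mean square and the ramps converge directly. *)

(** * Power means *)

(** Nonnegativity of this sum of squares is what the induction step of
    [sqr_sum_le] consumes, with [x] the newly added term. *)
Lemma sum_sqrB (R : comNzRingType) (I : Type) (s : seq I) (F : I -> R) x :
  \sum_(i <- s) (x - F i) ^+ 2 =
  (size s)%:R * x ^+ 2 - 2 * x * (\sum_(i <- s) F i) + \sum_(i <- s) F i ^+ 2.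
Proof.
elim: s => [|i s IHs]; first by rewrite !big_nil /=; ring.
by rewrite !big_cons IHs /= -[in RHS]natr1; ring.
Qed.

Lemma sqr_sum_le (R : realDomainType) (I : Type) (s : seq I) (F : I -> R) :
  (\sum_(i <- s) F i) ^+ 2 <= (size s)%:R * \sum_(i <- s) F i ^+ 2.
Proof.
elim: s => [|i s IHs]; first by rewrite !big_nil /= expr0n mul0r.
have : 0 <= \sum_(j <- s) (F i - F j) ^+ 2.
  by apply: sumr_ge0 => j _; rewrite sqr_ge0.
rewrite sum_sqrB !big_cons /= -[(size s).+1%:R]natr1; move: IHs.
set S := \sum_(j <- s) F j; set Q := \sum_(j <- s) F j ^+ 2.
set n : R := (size s)%:R => IHs dev.
have -> : (n + 1) * (F i ^+ 2 + Q) =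
  n * F i ^+ 2 + F i ^+ 2 + n * Q + Q by ring.
have -> : (F i + S) ^+ 2 = F i ^+ 2 + 2 * F i * S + S ^+ 2 by ring.
lra.
Qed.

Lemma exp4_sum_le (R : realDomainType) (I : Type) (s : seq I) (F : I -> R) :
  (\sum_(i <- s) F i) ^+ 4 <= (size s)%:R ^+ 3 * \sum_(i <- s) F i ^+ 4.
Proof.
have -> : (\sum_(i <- s) F i) ^+ 4 = ((\sum_(i <- s) F i) ^+ 2) ^+ 2.
  by rewrite -exprM.
apply: (@le_trans _ _ (((size s)%:R * \sum_(i <- s) F i ^+ 2) ^+ 2)).
  rewrite ler_sqr ?nnegrE ?sqr_ge0 ?mulr_ge0 ?sqr_sum_le//.
  by apply: sumr_ge0 => i _; rewrite sqr_ge0.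
rewrite exprMn (exprSr _ 2) -mulrA ler_wpM2l ?sqr_ge0//.
apply: le_trans (sqr_sum_le _ _) _.
by rewrite le_eqVlt; apply/orP; left; apply/eqP; congr (_ * _);
  apply: eq_bigr => i _; rewrite -exprM.
Qed.

(** * Expectations of real functions *)

Section Moments.
Context {d : measure_display} {T : measurableType d} {R : realType}.
Variable P : probability T R.
Implicit Types X Y Z : T -> R.

Definition mean X : R := fine 'E_P[X].

Definition integrable1 X := P.-integrable setT (EFin \o X).

Definition integrable2 X :=
  measurable_fun setT X /\ integrable1 (fun w => X w ^+ 2).

Lemma meanE X : mean X = \int[P]_w X w.
Proof. by rewrite /mean unlock. Qed.

Lemma integrable1_measurable X : integrable1 X -> measurable_fun setT X.
Proof. by move=> /measurable_int /measurable_EFinP. Qed.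

Lemma integrable1_ext X Y : X =1 Y -> integrable1 X -> integrable1 Y.
Proof. by move=> /funext ->. Qed.

Lemma integrable1_cst c : integrable1 (fun=> c).
Proof. exact: (finite_measure_integrable_cst P c measurableT). Qed.

Lemma integrable1D X Y : integrable1 X -> integrable1 Y ->
  integrable1 (fun w => X w + Y w).
Proof. by move=> iX iY; exact: (integrableD measurableT iX iY). Qed.

Lemma integrable1B X Y : integrable1 X -> integrable1 Y ->
  integrable1 (fun w => X w - Y w).
Proof. by move=> iX iY; exact: (integrableB measurableT iX iY). Qed.

Lemma integrable1Z c X : integrable1 X -> integrable1 (fun w => c * X w).
Proof. by move=> iX; exact: (integrableZl measurableT c iX). Qed.

Lemma integrable1_sum I (s : seq I) (D : pred I) (X : I -> T -> R) :
  (forall i, D i -> integrable1 (X i)) ->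
  integrable1 (fun w => \sum_(i <- s | D i) X i w).
Proof.
move=> iX.
have := @integrable_sum _ _ _ P _ measurableT _ s D (fun i w => (X i w)%:E) iX.
by under eq_fun do rewrite sumEFin.
Qed.

Lemma integrable1_norm X : integrable1 X -> integrable1 (fun w => `|X w|).
Proof. by move=> iX; exact: integrable_norm. Qed.

Lemma integrable1_le X Y : measurable_fun setT X -> integrable1 Y ->
  (forall w, `|X w| <= Y w) -> integrable1 X.
Proof.
move=> mX iY XY; apply: (le_integrable measurableT _ _ iY).
  exact/measurable_EFinP.
by move=> w _ /=; rewrite lee_fin (le_trans (XY w))// ler_norm.
Qed.

Lemma meanD X Y : integrable1 X -> integrable1 Y ->
  mean (fun w => X w + Y w) = mean X + mean Y.
Proof. by move=> iX iY; rewrite !meanE RintegralD. Qed.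

Lemma meanB X Y : integrable1 X -> integrable1 Y ->
  mean (fun w => X w - Y w) = mean X - mean Y.
Proof. by move=> iX iY; rewrite !meanE RintegralB. Qed.

Lemma meanZ c X : integrable1 X -> mean (fun w => c * X w) = c * mean X.
Proof. by move=> iX; rewrite !meanE RintegralZl. Qed.

Lemma mean_cst c : mean (fun=> c) = c.
Proof.
by rewrite /mean -[fun=> c]/(cst c) expectation_cst.
Qed.

Lemma mean_ext X Y : X =1 Y -> mean X = mean Y.
Proof. by move=> /funext ->. Qed.

Lemma mean_sum I (s : seq I) (D : pred I) (X : I -> T -> R) :
  (forall i, D i -> integrable1 (X i)) ->
  mean (fun w => \sum_(i <- s | D i) X i w) = \sum_(i <- s | D i) mean (X i).
Proof.
move=> iX; elim: s => [|i s IHs].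
  by under eq_fun do rewrite big_nil; rewrite big_nil mean_cst.
under eq_fun do rewrite big_cons; rewrite big_cons.
case: (boolP (D i)) => // Di; rewrite -IHs -meanD//; first exact: iX.
exact: integrable1_sum.
Qed.

Lemma mean_le X Y : integrable1 X -> integrable1 Y ->
  (forall w, X w <= Y w) -> mean X <= mean Y.
Proof. by move=> iX iY XY; rewrite !meanE le_Rintegral. Qed.

Lemma mean_ge0 X : (forall w, 0 <= X w) -> 0 <= mean X.
Proof. by move=> X0; rewrite meanE Rintegral_ge0. Qed.

Lemma norm_mean_le X Y : measurable_fun setT X -> integrable1 Y ->
  (forall w, `|X w| <= Y w) -> `|mean X| <= mean Y.
Proof.
move=> mX iY XY; have iX := integrable1_le mX iY XY.
apply: (@le_trans _ _ (mean (fun w => `|X w|))).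
  by rewrite !meanE le_normr_Rintegral.
by apply: mean_le => //; exact: integrable1_norm.
Qed.

(** Integrability of a product of two square integrable functions, from
    [2 |x y| <= x^2 + y^2]. *)
Lemma integrable1M X Y : integrable2 X -> integrable2 Y ->
  integrable1 (fun w => X w * Y w).
Proof.
move=> [mX iX] [mY iY]; apply: (integrable1_le _ (integrable1D iX iY)).
  exact: measurable_funM.
move=> w; rewrite normrM -(real_normK (num_real (X w))).
rewrite -(real_normK (num_real (Y w))).
have := sqr_ge0 (`|X w| - `|Y w|); have := normr_ge0 (X w).
have := normr_ge0 (Y w); nra.
Qed.

Lemma integrable2_cst c : integrable2 (fun=> c).
Proof. by split; [exact: measurable_cst|exact: integrable1_cst]. Qed.

Lemma integrable2_integrable1 X : integrable2 X -> integrable1 X.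
Proof.
move=> X2; apply: integrable1_ext (integrable1M X2 (integrable2_cst 1)) => w.
by rewrite mulr1.
Qed.

Lemma integrable2D X Y : integrable2 X -> integrable2 Y ->
  integrable2 (fun w => X w + Y w).
Proof.
move=> X2 Y2; split; first exact: measurable_funD X2.1 Y2.1.
apply: integrable1_ext (integrable1D (integrable1D X2.2 Y2.2)
  (integrable1Z 2 (integrable1M X2 Y2))) => w; ring.
Qed.

Lemma integrable2Z c X : integrable2 X -> integrable2 (fun w => c * X w).
Proof.
move=> [mX iX]; split; first by apply: measurable_funM => //.
by apply: integrable1_ext (integrable1Z (c ^+ 2) iX) => w; ring.
Qed.

Lemma integrable2B X Y : integrable2 X -> integrable2 Y ->
  integrable2 (fun w => X w - Y w).
Proof.
move=> X2 /(integrable2Z (-1)) Y2; have [m i] := integrable2D X2 Y2.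
by split; [apply: eq_measurable_fun m|apply: integrable1_ext i] => w *; ring.
Qed.

Lemma integrable2_sum I (s : seq I) (D : pred I) (X : I -> T -> R) :
  (forall i, D i -> integrable2 (X i)) ->
  integrable2 (fun w => \sum_(i <- s | D i) X i w).
Proof.
move=> iX; elim: s => [|i s IHs].
  by under eq_fun do rewrite big_nil; exact: integrable2_cst.
under eq_fun do rewrite big_cons.
by case: (boolP (D i)) => // Di; apply: integrable2D => //; exact: iX.
Qed.

Definition integrable4 X :=
  measurable_fun setT X /\ integrable1 (fun w => X w ^+ 4).

Lemma integrable4_sqr X : integrable4 X -> integrable2 (fun w => X w ^+ 2).
Proof.
move=> [mX iX]; split; first exact: measurable_funX.
by apply: integrable1_ext iX => w; ring.
Qed.

Lemma integrable4_integrable2 X : integrable4 X -> integrable2 X.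
Proof.
by move=> X4; split; [exact: X4.1|exact/integrable2_integrable1/integrable4_sqr].
Qed.

Lemma integrable4M X Y : integrable4 X -> integrable4 Y ->
  integrable2 (fun w => X w * Y w).
Proof.
move=> X4 Y4; split; first exact: measurable_funM X4.1 Y4.1.
apply: integrable1_ext (integrable1M (integrable4_sqr X4) (integrable4_sqr Y4)).
by move=> w; ring.
Qed.

Lemma integrable4D X Y : integrable4 X -> integrable4 Y ->
  integrable4 (fun w => X w + Y w).
Proof.
move=> X4 Y4; split; first exact: measurable_funD X4.1 Y4.1.
have [_] := integrable2D (integrable2D (integrable4_sqr X4) (integrable4_sqr Y4))
  (integrable2Z 2 (integrable4M X4 Y4)).
by apply: integrable1_ext => w; ring.
Qed.

Lemma integrable4Z c X : integrable4 X -> integrable4 (fun w => c * X w).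
Proof.
move=> [mX iX]; split; first by apply: measurable_funM => //.
by apply: integrable1_ext (integrable1Z (c ^+ 4) iX) => w; ring.
Qed.

Lemma integrable4_sum I (s : seq I) (D : pred I) (X : I -> T -> R) :
  (forall i, D i -> integrable4 (X i)) ->
  integrable4 (fun w => \sum_(i <- s | D i) X i w).
Proof.
move=> iX; elim: s => [|i s IHs].
  under eq_fun do rewrite big_nil.
  by split; [exact: measurable_cst|exact: integrable1_cst].
under eq_fun do rewrite big_cons.
by case: (boolP (D i)) => // Di; apply: integrable4D => //; exact: iX.
Qed.

(** Convexity of the fourth power; the terms may be dependent. *)
Lemma mean_exp4_sum I (s : seq I) (X : I -> T -> R) K n :
  0 <= K -> (size s <= n)%N ->
  (forall i, integrable4 (X i)) -> (forall i, mean (fun w => X i w ^+ 4) <= K) ->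
  mean (fun w => (\sum_(i <- s) X i w) ^+ 4) <= n%:R ^+ 4 * K.
Proof.
move=> K0 sn iX XK.
have i1 i : true -> integrable1 (fun w => X i w ^+ 4) by move=> _; exact: (iX i).2.
apply: (@le_trans _ _ (mean (fun w =>
    (size s)%:R ^+ 3 * \sum_(i <- s) X i w ^+ 4))).
  apply: mean_le; [|exact: integrable1Z (integrable1_sum _ i1)|].
    exact: (integrable4_sum _ (fun i (_ : xpredT i) => iX i)).2.
  by move=> w; exact: exp4_sum_le.
rewrite meanZ; last exact: integrable1_sum.
rewrite mean_sum//.
apply: (@le_trans _ _ ((size s)%:R ^+ 3 * ((size s)%:R * K))).
  rewrite ler_wpM2l ?exprn_ge0// mulr_natl -sum1_size -sumrMnr.
  by apply: ler_sum => i _; rewrite mulr1n.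
rewrite mulrA -exprSr ler_wpM2r//.
by rewrite lerXn2r ?nnegrE ?ler0n ?ler_nat.
Qed.

End Moments.

(** * Independence *)

Section Independence.
Context {d : measure_display} {T : measurableType d} {R : realType}.
Variable P : probability T R.
Implicit Types X Y Z : T -> R.

Definition independent X Y := forall A B : set R,
  measurable A -> measurable B ->
  P (X @^-1` A `&` Y @^-1` B) = (P (X @^-1` A) * P (Y @^-1` B))%E.

Lemma independent_comp X Y (f g : R -> R) : measurable_fun setT f ->
  measurable_fun setT g -> independent X Y -> independent (f \o X) (g \o Y).
Proof.
move=> mf mg XY A B mA mB; apply: (XY (f @^-1` A) (g @^-1` B)).
  by rewrite -[_ @^-1` _]setTI; exact: mf.
by rewrite -[_ @^-1` _]setTI; exact: mg.
Qed.

Section product_law.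
Variables X Y : T -> R.
Hypotheses (mX : measurable_fun setT X) (mY : measurable_fun setT Y).
Hypothesis XY : independent X Y.

Let X' : {RV P >-> R} := mfun_Sub (mem_set mX).
Let Y' : {RV P >-> R} := mfun_Sub (mem_set mY).
Let XY' : {RV P >-> (R * R)%type} :=
  mfun_Sub (mem_set (measurable_fun_pair mX mY)).

Lemma product_law (A : set (R * R)) : measurable A ->
  distribution P XY' A = (distribution P X' \x distribution P Y')%E A.
Proof.
Proof. by move=> mA; rewrite (product_measure_unique (m' := distribution P XY')). Qed.

(** Independence says that the law of the pair is the product of the laws, so
    Tonelli's theorem splits the integral. *)
Lemma ge0_independentM (f g : R -> R) : measurable_fun setT f ->
  measurable_fun setT g -> (forall x, 0 <= f x) -> (forall x, 0 <= g x) ->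
  (\int[P]_w (f (X w) * g (Y w))%:E =
   \int[P]_w (f (X w))%:E * \int[P]_w (g (Y w))%:E)%E.
Proof.
move=> mf mg f0 g0.
have mh : measurable_fun setT (fun z : R * R => f z.1 * g z.2).
  apply: measurable_funM; apply: measurableT_comp => //.
transitivity (\int[distribution P XY']_z (f z.1 * g z.2)%:E)%E.
  rewrite ge0_integral_distribution//; first exact/measurable_EFinP.
  by move=> z; rewrite lee_fin mulr_ge0.
rewrite (@eq_measure_integral _ _ _ _ (distribution P X' \x distribution P Y')%E);
  last by move=> A mA _; exact: product_law.
rewrite fubini_tonelli1//; last 2 first.
- exact/measurable_EFinP.
- by move=> z; rewrite lee_fin mulr_ge0.
rewrite /fubini_F /=.
under eq_integral.
  move=> x _; under eq_integral do rewrite EFinM.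
  rewrite ge0_integralZl//; last 3 first.
  - exact/measurable_EFinP.
  - by move=> y _; rewrite lee_fin.
  - by rewrite lee_fin.
  over.
rewrite ge0_integralZr//; last 3 first.
- exact/measurable_EFinP.
- by move=> y _; rewrite lee_fin.
- by apply: integral_ge0 => y _; rewrite lee_fin.
by rewrite !ge0_integral_distribution//;
  try exact/measurable_EFinP; move=> y; rewrite lee_fin.
Qed.

(** Stated in the extended reals: it is also used to deduce that a factor is
    integrable from the integrability of the product. *)
Lemma integral_norm_independentM : (\int[P]_w `|(X w * Y w)%:E| =
  \int[P]_w `|(X w)%:E| * \int[P]_w `|(Y w)%:E|)%E.
Proof.
rewrite -[RHS](@ge0_independentM Num.norm Num.norm)//.
by apply: eq_integral => w _; rewrite -normrM.
Qed.

Lemma independent_integrable1M : integrable1 P X -> integrable1 P Y ->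
  integrable1 P (fun w => X w * Y w).
Proof.
move=> /integrableP[_ iX] /integrableP[_ iY]; apply/integrableP; split.
  by apply/measurable_EFinP; exact: measurable_funM.
by rewrite /= integral_norm_independentM lte_mul_pinfty// ?integral_ge0//
  ge0_fin_numE ?integral_ge0.
Qed.

Lemma mean_independentM : integrable1 P X -> integrable1 P Y ->
  mean P (fun w => X w * Y w) = mean P X * mean P Y.
Proof.
move=> iX iY; have iXY := independent_integrable1M iX iY.
have mh : measurable_fun setT (fun z : R * R => (z.1 * z.2)%:E).
  apply/measurable_EFinP; apply: measurable_funM => //.
rewrite !meanE /Rintegral.
have -> : (\int[P]_w (X w * Y w)%:E = \int[distribution P XY']_z (z.1 * z.2)%:E)%E.
  by rewrite integral_distribution.
rewrite (@eq_measure_integral _ _ _ _ (distribution P X' \x distribution P Y')%E);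
  last by move=> A mA _; exact: product_law.
have iY' : (distribution P Y').-integrable setT (EFin : R -> \bar R).
  exact: integrable_pushforward.
have iX' : (distribution P X').-integrable setT (EFin : R -> \bar R).
  exact: integrable_pushforward.
have iXY' : (distribution P X' \x distribution P Y')%E.-integrable setT
    (fun z : R * R => (z.1 * z.2)%:E).
  apply/integrableP; split => //.
  rewrite (@eq_measure_integral _ _ _ _ (distribution P XY')); last first.
    by move=> A mA _; symmetry; exact: product_law.
  rewrite ge0_integral_distribution//; last exact: measurableT_comp.
  by case/integrableP : iXY.
rewrite -integral12_prod_meas1// /fubini_F /=.
under eq_integral.
  move=> x _; under eq_integral do rewrite EFinM.
  rewrite integralZl//.
  over.
rewrite -(fineK (integrable_fin_num measurableT iY')).
rewrite integralZr// !integral_distribution//.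
by rewrite fineM// ?(integrable_fin_num measurableT iX).
Qed.

End product_law.
End Independence.

(** * Blocks of independent variables *)

Section Dynkin.
Context {d : measure_display} {T : measurableType d} {R : realType}.
Variable P : probability T R.

Definition indep_event (C : set T) : set (set T) :=
  [set A | measurable A /\ P (A `&` C) = (P A * P C)%E].

(** Being independent of a fixed event passes to complements and to countable
    disjoint unions, by additivity of the measure. *)
Lemma dynkin_indep_event C : measurable C -> dynkin (indep_event C).
Proof.
move=> mC; split.
- by split => //; rewrite setTI probability_setT mul1e.
- move=> A [mA AC]; split; first exact: measurableC.
  rewrite setIC -setDE measureD//; last by rewrite ltey_eq fin_num_measure.
  rewrite [X in (_ - X)%E](_ : _ = (P A * P C)%E); last by rewrite setIC; exact: AC.
  by rewrite probability_setC// muleBl ?fin_num_measure// mul1e.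
- move=> F tF FC; split; first by apply: bigcup_measurable => i _; exact: (FC i).1.
  rewrite setI_bigcupl measure_bigcup//=; last 2 first.
    by move=> i _; apply: measurableI => //; exact: (FC i).1.
    exact: trivIset_setIr.
  under eq_eseriesr do rewrite (FC _).2.
  rewrite (@measure_bigcup _ _ _ P setT)//; last by move=> i _; exact: (FC i).1.
  rewrite muleC -(@fineK _ (P C)) ?fin_num_measure// -nneseriesZl//.
  by apply: eq_eseriesr => i _; rewrite muleC.
Qed.

Lemma indep_event_sigma (G : set (set T)) C : setI_closed G -> measurable C ->
  G `<=` indep_event C -> <<s G >> `<=` indep_event C.
Proof.
move=> GI mC GC; apply: lambda_system_subset => //.
exact/dynkin_lambda_system/dynkin_indep_event.
Qed.

End Dynkin.

Section Blocks.
Context {d : measure_display} {T : measurableType d} {R : realType}.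
Context {P : probability T R}.
Variables (I : finType) (X : I -> {RV P >-> R}).
Implicit Types D E : {set I}.

Definition block D : set (set T) :=
  \bigcup_(i in [set` D]) g_sigma_algebra_preimage (X i).

(** The generated sigma-algebra is put on the source type, so that every closure
    property of measurable functions applies verbatim to adapted ones. *)
Definition adapted D (Y : T -> R) :=
  measurable_fun setT (Y : g_sigma_algebraType (block D) -> R).

(** A generating class of a block that is stable under intersection, unlike
    [block] itself, as the pi-lambda theorem requires. *)
Definition cylinders D : set (set T) :=
  [set C | exists B : I -> set R, (forall i, measurable (B i)) /\
     C = \bigcap_(i in [set` D]) (X i @^-1` B i)].

Lemma block_sub_cylinders D : block D `<=` cylinders D.
Proof.
move=> A [i Di [B mB <-]]; exists (fun j => if j == i then B else setT); split.
  by move=> j; case: ifP.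
rewrite setTI; apply/seteqP; split => w.
  by move=> Bw j _ /=; case: eqP => [->|].
by move=> /(_ i Di) /=; rewrite eqxx.
Qed.

Lemma cylinders_measurable D A : cylinders D A -> measurable A.
Proof.
move=> [B [mB ->]]; apply: fin_bigcap_measurable => // i _.
by rewrite -[_ @^-1` _]setTI; exact: measurable_funPT.
Qed.

Lemma cylinders_setI D : setI_closed (cylinders D).
Proof.
move=> _ _ [B [mB ->]] [C [mC ->]]; exists (fun i => B i `&` C i); split.
  by move=> i; exact: measurableI.
by rewrite bigcapI.
Qed.

Lemma sigma_block_measurable D : <<s block D >> `<=` @measurable _ T.
Proof.
apply: smallest_sub; first exact: sigma_algebra_measurable.
by move=> A /block_sub_cylinders /cylinders_measurable.
Qed.

Lemma sigma_blockS D E : D \subset E -> <<s block D >> `<=` <<s block E >>.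
Proof.
move=> DE; apply: sub_sigma_algebra2 => A [i Di Ai]; exists i => //.
exact: (fintype.subsetP DE).
Qed.

Hypothesis indep : mutually_independent X.

Lemma cylinders_independent D E A B : (forall i, i \in D -> i \notin E) ->
  cylinders D A -> cylinders E B -> P (A `&` B) = (P A * P B)%E.
Proof.
move=> DE [F [mF ->]] [G [mG ->]].
pose H i := if i \in D then F i else G i.
have mH i : measurable (H i) by rewrite /H; case: ifP.
have -> : \bigcap_(i in [set` D]) (X i @^-1` F i) `&`
          \bigcap_(i in [set` E]) (X i @^-1` G i) =
          \bigcap_(i in [set` (D :|: E)]) (X i @^-1` H i).
  apply/seteqP; split => w.
    move=> [Fw Gw] i /=; rewrite inE /H.
    by case: (boolP (i \in D)) => [Di _|_ /= Ei]; [exact: Fw|exact: Gw].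
  move=> Hw; split => i /= iDE.
    by have := Hw i; rewrite /= inE iDE /H iDE => /(_ isT).
  have := Hw i; rewrite /= inE iDE orbT /H => /(_ isT).
  by case: ifP => // /DE; rewrite iDE.
rewrite !indep// -EFinM; congr (_%:E).
rewrite (eq_bigl (fun i => i \in [predU D & E])); last first.
  by move=> i; rewrite !inE.
rewrite bigU//=; last by rewrite disjoint_subset; apply/fintype.subsetP => i /DE.
congr (_ * _); apply: eq_bigr => i Di; rewrite /H.
  by rewrite Di.
by case: ifP => // /DE; rewrite Di.
Qed.

(** The pi-lambda theorem is applied twice, once for each of the two events,
    starting from cylinders. *)
Lemma sigma_block_independent D E A B : (forall i, i \in D -> i \notin E) ->
  <<s block D >> A -> <<s block E >> B -> P (A `&` B) = (P A * P B)%E.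
Proof.
move=> DE sA sB.
have {}sA : <<s cylinders D >> A.
  exact: sub_sigma_algebra2 (@block_sub_cylinders D) _ sA.
have {}sB : <<s cylinders E >> B.
  exact: sub_sigma_algebra2 (@block_sub_cylinders E) _ sB.
have CA C : cylinders E C -> indep_event P C A.
  move=> EC; have mC := cylinders_measurable EC.
  apply: (indep_event_sigma (@cylinders_setI D) mC _ sA) => A' DA'.
  by split; [exact: cylinders_measurable DA'|exact: cylinders_independent DE _ _].
have [mA _] : indep_event P setT A.
  by apply: CA; exists (fun=> setT); split => //; apply/seteqP; split.
have [_ +] := indep_event_sigma (@cylinders_setI E) mA (fun C EC => conj
   (cylinders_measurable EC) (etrans (congr1 P (setIC C A)) (etrans (CA C EC).2 (muleC _ _)))) sB.
by rewrite setIC => ->; rewrite muleC.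
Qed.

Lemma adapted_independent D E Y Z : (forall i, i \in D -> i \notin E) ->
  adapted D Y -> adapted E Z -> independent P Y Z.
Proof.
move=> DE aY aZ A B mA mB; apply: (sigma_block_independent DE).
  by have := aY measurableT A mA; rewrite setTI.
by have := aZ measurableT B mB; rewrite setTI.
Qed.

End Blocks.

Section Adapted.
Context {d : measure_display} {T : measurableType d} {R : realType}.
Context {P : probability T R}.
Variables (I : finType) (X : I -> {RV P >-> R}).
Implicit Types (D E : {set I}) (Y Z : T -> R).

Lemma adapted_measurable D Y : adapted X D Y -> measurable_fun setT Y.
Proof.
move=> aY _ B mB; have := aY measurableT B mB.
exact: sigma_block_measurable.
Qed.

Lemma adaptedS D E Y : D \subset E -> adapted X D Y -> adapted X E Y.
Proof.
by move=> DE aY _ B mB; apply: (sigma_blockS DE); exact: (aY measurableT B mB).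
Qed.

Lemma adapted_var D i : i \in D -> adapted X D (X i).
Proof.
move=> Di _ B mB; apply: sub_sigma_algebra; exists i => //.
by exists B.
Qed.

Lemma adapted_cst D c : adapted X D (fun=> c).
Proof. exact: measurable_cst. Qed.

Lemma adaptedD D Y Z : adapted X D Y -> adapted X D Z ->
  adapted X D (fun w => Y w + Z w).
Proof. exact: measurable_funD. Qed.

Lemma adaptedB D Y Z : adapted X D Y -> adapted X D Z ->
  adapted X D (fun w => Y w - Z w).
Proof. exact: measurable_funB. Qed.

Lemma adaptedM D Y Z : adapted X D Y -> adapted X D Z ->
  adapted X D (fun w => Y w * Z w).
Proof. exact: measurable_funM. Qed.

Lemma adapted_sum D J (s : seq J) (p : pred J) (Y : J -> T -> R) :
  (forall j, p j -> adapted X D (Y j)) ->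
  adapted X D (fun w => \sum_(j <- s | p j) Y j w).
Proof.
move=> aY; elim: s => [|j s IHs].
  by under eq_fun do rewrite big_nil; exact: adapted_cst.
under eq_fun do rewrite big_cons.
by case: (boolP (p j)) => // pj; apply: adaptedD => //; exact: aY.
Qed.

Lemma adapted_prod D J (s : seq J) (p : pred J) (Y : J -> T -> R) :
  (forall j, p j -> adapted X D (Y j)) ->
  adapted X D (fun w => \prod_(j <- s | p j) Y j w).
Proof.
move=> aY; elim: s => [|j s IHs].
  by under eq_fun do rewrite big_nil; exact: adapted_cst.
under eq_fun do rewrite big_cons.
by case: (boolP (p j)) => // pj; apply: adaptedM => //; exact: aY.
Qed.

Lemma adapted_indic D A : <<s block X D >> A -> adapted X D (\1_A).
Proof.
move=> DA; exact: (@measurable_indic _ (g_sigma_algebraType (block X D)) R setT A).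
Qed.

End Adapted.

(** * Stein's method for locally dependent summands *)

Definition within N (r : nat) (k j : 'I_N) : bool :=
  (k <= j + r)%N && (j <= k + r)%N.

Lemma within_refl N r (k : 'I_N) : within r k k.
Proof. by rewrite /within leq_addr. Qed.

Lemma size_within N r (k : 'I_N) : (size (enum (within r k)) <= r.*2.+1)%N.
Proof.
rewrite -(size_map val) -(size_iota (k - r) r.*2.+1).
apply: uniq_leq_size; first by rewrite map_inj_uniq ?enum_uniq//; exact: val_inj.
move=> _ /mapP[j + ->]; rewrite mem_enum mem_iota -[_ \in _]/(within r k j).
rewrite /within -mul2n /= => /andP[h1 h2]; lia.
Qed.

Lemma count_pairs N r : (N * (6 * r + 2) = N * (3 * r).*2.+1 + N)%N.
Proof. by rewrite -mulnSr -mul2n mulnA addn2. Qed.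

Lemma mulr_le_half_sqr (R : realFieldType) (x y : R) :
  x * y <= 2^-1 * (x ^+ 2 + y ^+ 2).
Proof. by have := sqr_ge0 (x - y); rewrite sqrrB; lra. Qed.

(** The weight [eps] stays free: the limit in the size of the array is taken for a
    fixed [eps], which is then made arbitrarily small. *)
Lemma young_le (R : realFieldType) (eps x y : R) : 0 < eps ->
  x * y <= 2^-1 * (eps * x ^+ 2 + eps^-1 * y ^+ 2).
Proof.
move=> e0; have : 0 <= eps^-1 * (eps * x - y) ^+ 2.
  by rewrite mulr_ge0 ?sqr_ge0// invr_ge0 ltW.
have -> : eps^-1 * (eps * x - y) ^+ 2 =
    eps * x ^+ 2 - 2 * (x * y) + eps^-1 * y ^+ 2 by field; rewrite gt_eqF.
lra.
Qed.

Lemma lipschitz_continuous (R : realType) (u : R -> R) (L : R) :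
  (forall x y, `|u x - u y| <= L * `|x - y|) -> continuous u.
Proof.
move=> u_lip x; apply/cvgrPdist_lt => e e0.
have L1 : 0 < `|L| + 1 by rewrite ltr_wpDl.
have : \forall y \near x, `|x - y| < e / (`|L| + 1).
  exact: (@cvgr_dist_lt _ _ _ _ _ id x (fun _ => id)) (divr_gt0 e0 L1).
apply: filterS => y; rewrite ltr_pdivlMr// => xy.
apply: le_lt_trans (u_lip x y) (le_lt_trans _ xy).
by rewrite mulrC ler_wpM2l// (le_trans (ler_norm L))// lerDl.
Qed.

Section LocalDependence.
Context {d : measure_display} {T : measurableType d} {R : realType}.
Variable P : probability T R.
Variables (N r : nat) (X : 'I_N -> T -> R) (kappa : R).

Let W w := \sum_j X j w.
Let near_sum k w := \sum_(j | within r k j) X j w.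
Let far_sum k w := \sum_(j | ~~ within r k j) X j w.
Let Q k w := X k w * near_sum k w.

Hypothesis kappa_ge0 : 0 <= kappa.
Hypothesis X4 : forall k, integrable4 P (X k).
Hypothesis X4_le : forall k, mean P (fun w => X k w ^+ 4) <= kappa.
Hypothesis X_mean : forall k, mean P (X k) = 0.
Hypothesis X_orth : forall k j, k != j -> mean P (fun w => X k w * X j w) = 0.
Hypothesis X_far : forall k, independent P (X k) (far_sum k).
Hypothesis Q_far : forall k j, ~~ within (3 * r) k j -> independent P (Q k) (Q j).

Let B : R := (r.*2.+1)%:R ^+ 4 * kappa.

Let X2 k : integrable2 P (X k). Proof. exact: integrable4_integrable2. Qed.
Let near4 k : integrable4 P (near_sum k). Proof. exact: integrable4_sum. Qed.
Let Q2 k : integrable2 P (Q k). Proof. exact: integrable4M. Qed.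
Let Q1 k : integrable1 P (Q k). Proof. exact: integrable2_integrable1. Qed.
Let W2 : integrable2 P W. Proof. exact: integrable2_sum. Qed.

Let B_ge0 : 0 <= B. Proof. by rewrite mulr_ge0// exprn_ge0. Qed.

Let kappa_le_B : kappa <= B.
Proof. by rewrite ler_peMl// exprn_ege1// ler1n. Qed.

Let near4_le k : mean P (fun w => near_sum k w ^+ 4) <= B.
Proof.
have -> : (fun w => near_sum k w ^+ 4) =
    (fun w => (\sum_(j <- enum (within r k)) X j w) ^+ 4).
  by apply/funext => w; rewrite big_enum.
by apply: mean_exp4_sum => //; exact: size_within.
Qed.

Let Q2_le k : mean P (fun w => Q k w ^+ 2) <= B.
Proof.
apply: (@le_trans _ _ (mean P (fun w =>
    2^-1 * (X k w ^+ 4 + near_sum k w ^+ 4)))).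
  apply: mean_le; [exact: (Q2 k).2| |].
    by apply: integrable1Z; apply: integrable1D; [exact: (X4 k).2|exact: (near4 k).2].
  by move=> w; rewrite /Q exprMn !(exprM _ 2 2); exact: mulr_le_half_sqr.
rewrite meanZ; last by apply: integrable1D; [exact: (X4 k).2|exact: (near4 k).2].
rewrite meanD; [|exact: (X4 k).2|exact: (near4 k).2].
have := le_trans (X4_le k) kappa_le_B; have := near4_le k.
by move: (mean P _) (mean P _) (B) => x y z; lra.
Qed.

Let mean_XX k j : mean P (fun w => X k w * X j w) =
  if k == j then mean P (fun w => X k w ^+ 2) else 0.
Proof. by case: eqVneq => [->|/X_orth//]; apply: mean_ext => w; ring. Qed.

Lemma mean_sqr_sum_orth : mean P (fun w => W w ^+ 2) =
  \sum_k mean P (fun w => X k w ^+ 2).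
Proof.
have -> : (fun w => W w ^+ 2) = (fun w => \sum_k \sum_j X k w * X j w).
  by apply/funext => w; rewrite /W expr2 mulr_suml; apply: eq_bigr => k _; rewrite mulr_sumr.
rewrite mean_sum; last by move=> k _; apply: integrable1_sum => j _; exact: integrable1M.
apply: eq_bigr => k _; rewrite mean_sum; last by move=> j _; exact: integrable1M.
under eq_bigr do rewrite mean_XX; rewrite -big_mkcond.
by rewrite (big_pred1 k)// => j; rewrite eq_sym.
Qed.

Let V := mean P (fun w => W w ^+ 2).
Let q k w := Q k w - mean P (Q k).

(** Orthogonality leaves only the diagonal term of [X k * near_sum k], so the
    means of the [Q k] add up to the variance of [W]. *)
Let mean_Q k : mean P (Q k) = mean P (fun w => X k w ^+ 2).
Proof.
have -> : Q k = (fun w => \sum_(j | within r k j) X k w * X j w).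
  by apply/funext => w; rewrite /Q /near_sum mulr_sumr.
rewrite mean_sum; last by move=> j _; exact: integrable1M.
under eq_bigr do rewrite mean_XX.
rewrite -big_mkcondr (big_pred1 k)// => j; rewrite /= [in RHS]eq_sym.
by case: eqVneq => [->|]; rewrite ?within_refl ?andbF.
Qed.

Let V_sum : V = \sum_k mean P (Q k).
Proof. by rewrite /V mean_sqr_sum_orth; apply: eq_bigr => k _; rewrite mean_Q. Qed.

Let V_ge0 : 0 <= V. Proof. by apply: mean_ge0 => w; exact: sqr_ge0. Qed.

Let q2 k : integrable2 P (q k).
Proof. by apply: integrable2B => //; exact: integrable2_cst. Qed.

Let mean_q k : mean P (q k) = 0.
Proof. by rewrite meanB ?mean_cst ?subrr//; exact: integrable1_cst. Qed.

Let q2_le k : mean P (fun w => q k w ^+ 2) <= B.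
Proof.
apply: le_trans (Q2_le k).
have -> : (fun w => q k w ^+ 2) =
  (fun w => Q k w ^+ 2 - (2 * mean P (Q k) * Q k w - mean P (Q k) ^+ 2)).
  by apply/funext => w; rewrite /q; ring.
have i1 := integrable1Z (2 * mean P (Q k)) (Q1 k).
have ic := integrable1_cst P (mean P (Q k) ^+ 2).
rewrite meanB; [|exact: (Q2 k).2|exact: integrable1B].
rewrite meanB// meanZ// mean_cst.
have := sqr_ge0 (mean P (Q k)); rewrite !expr2; lra.
Qed.

Let mean_qq k j : mean P (fun w => q k w * q j w) <=
  if within (3 * r) k j then B else 0.
Proof.
case: ifPn => kj.
  apply: (@le_trans _ _ (mean P (fun w => 2^-1 * (q k w ^+ 2 + q j w ^+ 2)))).
    apply: mean_le; first exact: integrable1M.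
      by apply: integrable1Z; apply: integrable1D; [exact: (q2 k).2|exact: (q2 j).2].
    by move=> w; exact: mulr_le_half_sqr.
  rewrite meanZ; last by apply: integrable1D; [exact: (q2 k).2|exact: (q2 j).2].
  rewrite meanD; [|exact: (q2 k).2|exact: (q2 j).2].
  have := q2_le k; have := q2_le j.
  by move: (mean P _) (mean P _) (B) => x y z; lra.
have indq : independent P (q k) (q j).
  have mB c : measurable_fun setT (fun x : R => x - c).
    by apply: measurable_funB.
  exact: independent_comp (mB (mean P (Q k))) (mB (mean P (Q j))) (Q_far kj).
by rewrite mean_independentM ?mean_q ?mul0r//;
  [exact: (q2 k).1|exact: (q2 j).1|exact: integrable2_integrable1..].
Qed.

Let q_sum w := \sum_k q k w.

Let q_sum2 : integrable2 P q_sum. Proof. exact: integrable2_sum. Qed.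

(** For each [k], only the at most [6 r + 1] indices within [3 r] of [k] contribute
    a covariance. *)
Let mean_q_sum2 : mean P (fun w => q_sum w ^+ 2) <= (N * (3 * r).*2.+1)%:R * B.
Proof.
have -> : (fun w => q_sum w ^+ 2) = (fun w => \sum_k \sum_j q k w * q j w).
  by apply/funext => w; rewrite /q_sum expr2 mulr_suml; apply: eq_bigr => k _; rewrite mulr_sumr.
rewrite mean_sum; last by move=> k _; apply: integrable1_sum => j _; exact: integrable1M.
have row k : mean P (fun w => \sum_j q k w * q j w) <= (3 * r).*2.+1%:R * B.
  rewrite mean_sum; last by move=> j _; exact: integrable1M.
  apply: (@le_trans _ _ (\sum_j if within (3 * r) k j then B else 0)).
    by apply: ler_sum => j _; exact: mean_qq.
  rewrite -big_mkcond -big_enum big_const_seq count_predT iter_addr_0 -[leLHS]mulr_natl.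
  by rewrite ler_wpM2r// ler_nat; exact: size_within.
apply: (@le_trans _ _ (\sum_(k < N) (3 * r).*2.+1%:R * B)).
  by apply: ler_sum => k _; exact: row.
by rewrite sumr_const card_ord -[leLHS]mulr_natl natrM mulrA.
Qed.

Variables (f g : R -> R) (L : R).
Hypothesis fg : forall x, is_derive x (1 : R) f (g x).
Hypothesis g_le : forall x, `|g x| <= L.
Hypothesis g_lip : forall x y, `|g x - g y| <= L * `|x - y|.

Let L_ge0 : 0 <= L. Proof. exact: le_trans (g_le 0). Qed.

Let f_cont : continuous f.
Proof.
by move=> x; apply: differentiable_continuous; apply/derivable1_diffP; case: (fg x).
Qed.

Let f_meas : measurable_fun setT f.
Proof. exact: continuous_measurable_fun. Qed.

Let g_cont : continuous g. Proof. exact: lipschitz_continuous g_lip. Qed.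

Let g_meas : measurable_fun setT g.
Proof. exact: continuous_measurable_fun. Qed.

Let mvt x y : exists2 z, f y - f x = g z * (y - x) & `|z - y| <= `|y - x|.
Proof.
have segment a b : a <= b -> exists2 z, f b - f a = g z * (b - a) & a <= z <= b.
  move=> ab; have [|z] := @MVT_segment R f g a b ab (fun x _ => fg x).
    exact: continuous_subspaceT.
  by rewrite in_itv => zab fz; exists z.
have [xy|yx] := leP x y.
  have [z fz /andP[xz zy]] := segment x y xy; exists z => //.
  by rewrite distrC !ger0_norm ?subr_ge0//; lra.
have [z fz /andP[yz zx]] := segment y x (ltW yx); exists z.
  by rewrite -(opprB (f x)) fz; ring.
by rewrite (distrC y) !ger0_norm ?subr_ge0//; lra.
Qed.

(** No second derivative of [f] is available, but the increment of [f] is a value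
    of [g] nearby and [g] is Lipschitz. *)
Let taylor s u : `|f s - f (s - u) - u * g s| <= L * u ^+ 2.
Proof.
have [z -> zs] := mvt (s - u) s.
have -> : g z * (s - (s - u)) - u * g s = u * (g z - g s) by ring.
rewrite normrM -real_normK ?num_real// (expr2 `|u|) mulrCA ler_wpM2l//.
have su : s - (s - u) = u by ring.
rewrite su in zs.
by apply: le_trans (g_lip z s) _; rewrite ler_wpM2l.
Qed.

(** A bounded derivative gives [f] at most linear growth. *)
Let f2 Y : integrable2 P Y -> integrable2 P (f \o Y).
Proof.
move=> Y2; have mY := Y2.1; split; first exact: measurableT_comp.
have i2 : integrable2 P (fun w => `|f 0| + L * `|Y w|).
  apply: integrable2D; first exact: integrable2_cst.
  apply: integrable2Z; split; first exact: measurableT_comp.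
  by apply: integrable1_ext Y2.2 => w; rewrite real_normK ?num_real.
apply: integrable1_le i2.2 _; first by apply: measurable_funX; exact: measurableT_comp.
move=> w; rewrite ger0_norm ?sqr_ge0//= -real_normK ?num_real//.
rewrite ler_sqr ?nnegrE ?addr_ge0 ?mulr_ge0//.
have [z] := mvt 0 (Y w); rewrite subr0 => fz _.
have -> : f (Y w) = f 0 + g z * Y w by rewrite -fz; ring.
by rewrite (le_trans (ler_normD _ _))// lerD2l normrM ler_wpM2r.
Qed.

Let far2 k : integrable2 P (far_sum k). Proof. exact: integrable2_sum. Qed.

Let W_split k w : W w - near_sum k w = far_sum k w.
Proof. by rewrite /W (bigID (within r k)) /= [X in X - _]addrC addrK. Qed.

Let mean_X_far k : mean P (fun w => X k w * f (far_sum k w)) = 0.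
Proof.
have ind : independent P (X k) (f \o far_sum k).
  exact: (independent_comp (f := id) _ _ (X_far k)).
have i2 := f2 (far2 k).
rewrite (@mean_independentM _ _ _ P (X k) (f \o far_sum k))//.
- by rewrite X_mean mul0r.
- exact: (X2 k).1.
- exact: i2.1.
- exact: integrable2_integrable1.
- exact: integrable2_integrable1.
Qed.

Let remainder w := \sum_k X k w *
  (f (W w) - f (far_sum k w) - near_sum k w * g (W w)).

Let decomposition w : W w * f (W w) - V * g (W w) =
  q_sum w * g (W w) + remainder w + \sum_k X k w * f (far_sum k w).
Proof.
rewrite /W /remainder /q_sum V_sum !mulr_suml -!big_split -sumrB /=.
by apply: eq_bigr => k _; rewrite /q /Q; ring.
Qed.

Let remainder_le eps w : 0 < eps -> `|remainder w| <=
  L / 2 * \sum_k (eps * X k w ^+ 2 + eps^-1 * near_sum k w ^+ 4).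
Proof.
move=> e0; rewrite mulr_sumr; apply: le_trans (ler_norm_sum _ _ _) _.
apply: ler_sum => k _; rewrite normrM.
rewrite -W_split; have t := taylor (W w) (near_sum k w).
apply: le_trans (ler_wpM2l (normr_ge0 _) t) _.
rewrite mulrCA -mulrA ler_wpM2l//.
rewrite -(real_normK (num_real (X k w))) (exprM _ 2 2).
exact: young_le.
Qed.

Let measurable_gW : measurable_fun setT (g \o W).
Proof. exact: measurableT_comp W2.1. Qed.

Let gW2 : integrable2 P (g \o W).
Proof.
split => //; apply: integrable1_le (integrable1_cst P (L ^+ 2)) _.
  exact: measurable_funX.
by move=> w; rewrite normrX /= ler_sqr ?nnegrE.
Qed.

(** Replacing each [f W] by [f] of the part of [W] that is independent of [X k]
    costs a second order term, bounded through [2 |x| y^2 <= eps x^2 + y^4 / eps]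
    so that only second and fourth moments occur. *)
Theorem stein_bound eps : 0 < eps ->
  `|mean P (fun w => W w * f (W w)) - V * mean P (fun w => g (W w))| <=
  L * (eps + eps * V + (N * (6 * r + 2))%:R * B / eps).
Proof.
move=> e0.
have iWf := integrable1M W2 (f2 W2).
have igW := integrable2_integrable1 gW2.
have iqg := integrable1M q_sum2 gW2.
have iXf k : integrable1 P (fun w => X k w * f (far_sum k w)).
  exact: integrable1M (X2 k) (f2 (far2 k)).
have irem : integrable1 P (fun w =>
    L / 2 * \sum_k (eps * X k w ^+ 2 + eps^-1 * near_sum k w ^+ 4)).
  apply: integrable1Z; apply: integrable1_sum => k _; apply: integrable1D.
    by apply: integrable1Z; exact: (X2 k).2.
  by apply: integrable1Z; exact: (near4 k).2.
have mrem : measurable_fun setT remainder.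
  rewrite /remainder; apply: measurable_sum => k; apply: measurable_funM.
    exact: (X2 k).1.
  apply: measurable_funB; last exact: measurable_funM (near4 k).1 _.
  by apply: measurable_funB; [exact: (f2 W2).1|exact: (f2 (far2 k)).1].
have irem' := integrable1_le mrem irem (fun w => remainder_le w e0).
rewrite -meanZ// -meanB//; last exact: integrable1Z.
rewrite (mean_ext P decomposition) meanD; last 2 first.
- exact: integrable1D.
- by apply: integrable1_sum => k _; exact: iXf.
rewrite meanD// [X in _ + _ + X]mean_sum; last by move=> k _; exact: iXf.
rewrite [X in _ + _ + X]big1 ?addr0; last by move=> k _; exact: mean_X_far.
apply: le_trans (ler_normD _ _) _.
have le1 : `|mean P (fun w => q_sum w * g (W w))| <=
    L / 2 * (eps + eps^-1 * ((N * (3 * r).*2.+1)%:R * B)).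
  apply: (@le_trans _ _ (mean P (fun w => L / 2 * (eps + eps^-1 * q_sum w ^+ 2)))).
    apply: norm_mean_le; first exact: integrable1_measurable iqg.
  - by apply: integrable1Z; apply: integrable1D;
      [exact: integrable1_cst|apply: integrable1Z; exact: q_sum2.2].
  - move=> w; rewrite normrM mulrC.
    apply: (@le_trans _ _ (L * `|q_sum w|)); first by rewrite ler_wpM2r.
    rewrite -mulrA ler_wpM2l// -[`|_|]mul1r.
    by apply: le_trans (young_le _ _ e0) _;
      rewrite real_normK ?num_real// expr1n mulr1.
  have i1 := integrable1_cst P eps; have i2 := integrable1Z eps^-1 q_sum2.2.
  rewrite meanZ; last exact: integrable1D.
  rewrite meanD// mean_cst meanZ; last exact: q_sum2.2.
  rewrite ler_wpM2l ?divr_ge0// lerD2l ler_wpM2l//.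
  by rewrite invr_ge0 ltW.
have le2 : `|mean P remainder| <= L / 2 * (eps * V + eps^-1 * (N%:R * B)).
  apply: le_trans (norm_mean_le mrem irem (fun w => remainder_le w e0)) _.
  have i1 k : integrable1 P (fun w => eps * X k w ^+ 2).
    by apply: integrable1Z; exact: (X2 k).2.
  have i2 k : integrable1 P (fun w => eps^-1 * near_sum k w ^+ 4).
    by apply: integrable1Z; exact: (near4 k).2.
  have i12 k : true -> integrable1 P (fun w => eps * X k w ^+ 2 + eps^-1 * near_sum k w ^+ 4).
    by move=> _; exact: integrable1D.
  rewrite meanZ; last exact: integrable1_sum.
  rewrite ler_wpM2l ?divr_ge0// mean_sum//.
  apply: (@le_trans _ _ (\sum_k (eps * mean P (fun w => X k w ^+ 2) + eps^-1 * B))).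
    apply: ler_sum => k _; rewrite meanD// !meanZ; [|exact: (near4 k).2|exact: (X2 k).2].
    by rewrite lerD2l ler_wpM2l// invr_ge0 ltW.
  rewrite big_split /= -mulr_sumr sumr_const card_ord -mean_sqr_sum_orth -/V.
  by rewrite lerD2l -[leLHS]mulr_natl mulrCA.
apply: le_trans (lerD le1 le2) _.
rewrite -[leLHS]mulrDr -[leLHS]mulrA ler_wpM2l//.
rewrite count_pairs natrD.
have e1 : 0 <= eps^-1 by rewrite invr_ge0 ltW.
have := mulr_ge0 e1 (mulr_ge0 (ler0n R (N * (3 * r).*2.+1)) B_ge0).
have := mulr_ge0 e1 (mulr_ge0 (ler0n R N) B_ge0).
have := mulr_ge0 (ltW e0) V_ge0.
rewrite mulrDl mulrDl !(mulrC _ eps^-1).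
move: (eps^-1 * _) (eps^-1 * _) (eps * V) => x y z; lra.
Qed.

End LocalDependence.

(** * Gaussian tails *)

(** The function decreases towards its limit. *)
Lemma derive_le0_cvg0_ge0 (R : realType) (u du : R -> R) (B : R) :
  (forall x : R, B < x -> is_derive x (1 : R) u (du x)) ->
  (forall x, B < x -> du x <= 0) -> u x @[x --> +oo] --> 0 ->
  forall x, B < x -> 0 <= u x.
Proof.
move=> du_u du0 u0 x Bx; rewrite leNgt; apply/negP => ux.
have nonincr y : x < y -> u y <= u x.
  move=> xy; have [||z] := @MVT_segment R u du x y (ltW xy).
  - by move=> z; rewrite in_itv /= => /andP[xz _]; apply: du_u; exact: lt_trans xz.
  - apply: derivable_within_continuous => z; rewrite in_itv /= => /andP[xz _].
    by have [] := du_u z (lt_le_trans Bx xz).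
  rewrite in_itv /= => /andP[xz _] uyx; rewrite -subr_le0 uyx.
  by rewrite mulr_le0_ge0 ?subr_ge0 ?(ltW xy)// du0// (lt_le_trans Bx xz).
have : \forall y \near +oo, u x < u y by exact: cvgr_gt u0 _ ux.
move=> [M [_ uM]]; have := uM (Num.max M x + 1).
rewrite ltr_pwDr ?le_max ?lexx// => /(_ isT).
by rewrite ltNge nonincr// ltr_pwDr ?le_max ?lexx ?orbT.
Qed.

Section Mills.
Context {R : realType}.
Variables (phi : R -> R) (v : R).
Hypothesis v_gt0 : 0 < v.
Hypothesis phi_gt0 : forall x, 0 < phi x.
Hypothesis dphi : forall x, is_derive x (1 : R) phi (- (x / v) * phi x).
Hypothesis phi_cvg : phi x @[x --> +oo] --> 0.

Variables (G : R -> R) (B k : R).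
Hypothesis B_ge1 : 1 <= B.
Hypothesis k_ge0 : 0 <= k.
Hypothesis dG : forall x, B < x -> is_derive x (1 : R) G (- k * phi x).
Hypothesis G_cvg : G x @[x --> +oo] --> 0.

Let gtB_gt0 x : B < x -> 0 < x.
Proof. by move=> Bx; exact: lt_trans (lt_le_trans ltr01 B_ge1) Bx. Qed.

Let phi_inv_cvg : phi x / x @[x --> +oo] --> 0.
Proof.
apply: (@squeeze_cvgr _ _ _ _ (fun=> 0) phi) => //; last exact: cvg_cst.
near=> x; have x1 : 1 <= x by near: x; exact: nbhs_pinfty_ge.
have x0 : 0 < x by exact: lt_le_trans x1.
by rewrite divr_ge0 ?(ltW x0) ?(ltW (phi_gt0 x))//= ler_pdivrMr// ler_peMr// ltW.
Unshelve. all: by end_near. Qed.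

Let phi_ratio_cvg : phi x * (x / (x ^+ 2 + v)) @[x --> +oo] --> 0.
Proof.
apply: (@squeeze_cvgr _ _ _ _ (fun=> 0) phi) => //; last exact: cvg_cst.
near=> x; have x1 : 1 <= x by near: x; exact: nbhs_pinfty_ge.
have x0 : 0 <= x by exact: le_trans x1.
have x2v : 0 < x ^+ 2 + v by rewrite ltr_wpDl ?sqr_ge0.
apply/andP; split; first by rewrite !mulr_ge0 ?invr_ge0 ?(ltW (phi_gt0 x)) ?(ltW x2v).
rewrite ler_piMr ?(ltW (phi_gt0 x))// ler_pdivrMr// mul1r.
by rewrite ler_wpDr ?(ltW v_gt0)// expr2 ler_peMl.
Unshelve. all: by end_near. Qed.

(** The derivative of [k v phi x / x] is [- k phi x (1 + v / x^2)], below that of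
    [G], so the difference of the two sides decreases to [0]. *)
Lemma mills_upper x : B < x -> G x <= k * v * (phi x / x).
Proof.
move=> Bx; rewrite -subr_ge0.
pose du x := - k * v * phi x / x ^+ 2.
apply: (@derive_le0_cvg0_ge0 _ (fun x => k * v * (phi x / x) - G x) du B) => //.
- move=> y By; have y0 := gtB_gt0 By.
  have dGy := dG By; have dphiy := dphi y.
  have dinv : is_derive y (1 : R) (fun y : R => y^-1) (- y ^- 2 *: 1).
    by apply: is_deriveV; rewrite gt_eqF.
  apply: is_derive_eq; rewrite /du /GRing.scale /=.
  by field; rewrite !gt_eqF.
- move=> y By; have y0 := gtB_gt0 By.
  by rewrite /du !mulNr oppr_le0 !mulr_ge0 ?invr_ge0 ?exprn_ge0 ?(ltW v_gt0) ?(ltW (phi_gt0 y)) ?(ltW y0).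
- rewrite -[0](subrr 0) -{1}(mulr0 (k * v)); apply: cvgB => //.
  by apply: cvgM => //; exact: cvg_cst.
Qed.

(** The derivative of [k v phi x * x / (x^2 + v)] exceeds [- k phi x] by
    [2 k v^2 phi x / (x^2 + v)^2], so the difference of the two sides decreases
    to [0]. *)
Lemma mills_lower x : B < x -> k * v * (phi x * (x / (x ^+ 2 + v))) <= G x.
Proof.
move=> Bx; rewrite -subr_ge0.
pose du x := - (2 * k * v ^+ 2 * phi x / (x ^+ 2 + v) ^+ 2).
apply: (@derive_le0_cvg0_ge0 _
  (fun x => G x - k * v * (phi x * (x / (x ^+ 2 + v)))) du B) => //.
- move=> y By; have y0 := gtB_gt0 By.
  have y2 : 0 < y ^+ 2 + v by rewrite ltr_wpDl ?sqr_ge0.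
  have dGy := dG By; have dphiy := dphi y.
  have dinv : is_derive y (1 : R) (fun y : R => (y ^+ 2 + v)^-1)
      (- (y ^+ 2 + v) ^- 2 *: (2 * y)).
    apply: is_deriveV; first by rewrite gt_eqF.
    by apply: is_derive_eq; rewrite /GRing.scale /=; ring.
  apply: is_derive_eq; rewrite /du /GRing.scale /=.
  by field; rewrite !gt_eqF.
- move=> y By; rewrite /du oppr_le0.
  by rewrite !mulr_ge0 ?invr_ge0 ?exprn_ge0 ?(ltW v_gt0) ?(ltW (phi_gt0 y))//; rewrite addr_ge0 ?sqr_ge0 ?ltW.
- rewrite -[0](subrr 0) -{2}(mulr0 (k * v)); apply: cvgB => //.
  by apply: cvgM => //; exact: cvg_cst.
Qed.

(** The two bounds make [f = G / (v phi)] satisfy [x f <= k] and keep the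
    derivative [f + x (x f - k) / v] of [x f] within [0, k]. *)
Lemma mills_ratio x : B < x -> let f := G x / (v * phi x) in
  [/\ 0 <= x * f, x * f <= k, 0 <= f + x * (x * f - k) / v
    & f + x * (x * f - k) / v <= k].
Proof.
move=> Bx f; have x0 := gtB_gt0 Bx; have p0 := phi_gt0 x.
have x1 : 1 < x by exact: le_lt_trans Bx.
have x2v : 0 < x ^+ 2 + v by rewrite ltr_wpDl ?sqr_ge0.
have fG : G x = v * phi x * f by rewrite /f; field; rewrite !gt_eqF.
have up : x * f <= k.
  have := mills_upper Bx; rewrite fG.
  have -> : k * v * (phi x / x) = v * phi x * (k / x) by field; rewrite gt_eqF.
  by rewrite ler_pM2l ?mulr_gt0// ler_pdivlMr// mulrC.
have low : k * x <= f * (x ^+ 2 + v).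
  have := mills_lower Bx; rewrite fG.
  have -> : k * v * (phi x * (x / (x ^+ 2 + v))) =
      v * phi x * (k * x / (x ^+ 2 + v)) by field; rewrite gt_eqF.
  by rewrite ler_pM2l ?mulr_gt0// ler_pdivrMr.
have f0 : 0 <= f.
  by rewrite -(pmulr_lge0 _ x2v) (le_trans _ low)// mulr_ge0// ltW.
have -> : f + x * (x * f - k) / v = (f * (x ^+ 2 + v) - k * x) / v.
  by field; rewrite gt_eqF.
split=> //; first by rewrite mulr_ge0// ltW.
  by rewrite divr_ge0 ?subr_ge0// ltW.
rewrite ler_pdivrMr//; nra.
Qed.

End Mills.

(** * The Stein equation of a centered Gaussian law *)

Definition ramp (R : realType) (a b x : R) : R :=
  Num.max 0 (Num.min 1 ((b - x) / (b - a))).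

Section Ramp.
Context {R : realType}.
Variables a b : R.
Hypothesis ab : a < b.

Let ba0 : 0 < b - a. Proof. by rewrite subr_gt0. Qed.

Lemma ramp_ge0 x : 0 <= ramp a b x.
Proof. by rewrite /ramp le_max lexx. Qed.

Lemma ramp_le1 x : ramp a b x <= 1.
Proof. by rewrite /ramp ge_max ler01 ge_min lexx. Qed.

Lemma ramp_left x : x <= a -> ramp a b x = 1.
Proof.
move=> xa; rewrite /ramp min_l; first by rewrite max_r.
by rewrite ler_pdivlMr// mul1r; lra.
Qed.

Lemma ramp_right x : b <= x -> ramp a b x = 0.
Proof.
move=> bx; rewrite /ramp max_l// ge_min; apply/orP; right.
by rewrite pmulr_lle0 ?invr_gt0// subr_le0.
Qed.

Lemma ramp_lip x y : `|ramp a b x - ramp a b y| <= (b - a)^-1 * `|x - y|.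
Proof.
have clip u t : `|Num.max 0 (Num.min 1 u) - Num.max 0 (Num.min 1 t)| <= `|u - t| :> R.
  have := ler_norm (u - t); have := ler_norm (t - u); rewrite distrC.
  move: `|_ - t| => z; rewrite ler_norml !maxEle !minEle.
  by do !case: ifPn; rewrite -?ltNge => *; lra.
rewrite /ramp; apply: le_trans (clip _ _) _.
rewrite -mulrBl (_ : b - x - (b - y) = y - x); last by ring.
by rewrite normrM mulrC distrC ler_wpM2r// ger0_norm// invr_ge0 ltW.
Qed.

Lemma ramp_continuous : continuous (ramp a b).
Proof. exact: lipschitz_continuous ramp_lip. Qed.

End Ramp.

Lemma continuous_bounded_outside (R : realType) (u : R -> R) (B M : R) :
  continuous u -> (forall x, B < `|x| -> `|u x| <= M) ->
  exists K, forall x, `|u x| <= K.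
Proof.
move=> cu uM; have [z _ uz] : exists2 z, z \in `[- `|B|, `|B|] &
    forall t, t \in `[- `|B|, `|B|] -> `|u t| <= `|u z|.
  apply: (EVT_max (f := fun x => `|u x|)); first by have := normr_ge0 B; lra.
  apply: continuous_subspaceT => x; apply: continuous_comp; first exact: cu.
  exact: norm_continuous.
exists (Num.max M `|u z|) => x; rewrite le_max.
have [Bx|xB] := ltP B `|x|; first by rewrite uM.
by rewrite uz ?orbT// in_itv /= -ler_norml (le_trans xB)// ler_norm.
Qed.

Section SteinEquation.
Context {R : realType}.
Variables (s a b : R).
Hypotheses (s_neq0 : s != 0) (ab : a < b).
Notation leb := (@lebesgue_measure R).
Let phi : R -> R := normal_pdf 0 s.
Let v := s ^+ 2.
Let h := ramp a b.

Let v_gt0 : 0 < v. Proof. by rewrite exprn_even_gt0. Qed.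

Let phiE x : phi x = normal_peak s * expR (- x ^+ 2 / (v *+ 2)).
Proof. by rewrite /phi normal_pdfE// /normal_fun subr0. Qed.

Let phi_gt0 x : 0 < phi x.
Proof. by rewrite phiE mulr_gt0 ?expR_gt0// normal_peak_gt0. Qed.

Let phi_even x : phi (- x) = phi x.
Proof. by rewrite !phiE sqrrN. Qed.

Let dphi x : is_derive x (1 : R) phi (- (x / v) * phi x).
Proof.
rewrite (_ : phi = fun x => normal_peak s * expR (- x ^+ 2 / (v *+ 2)));
  last by apply/funext => y; exact: phiE.
apply: is_derive_eq; rewrite /GRing.scale /=.
by field; rewrite gt_eqF.
Qed.

Let phi_cvg : phi x @[x --> +oo] --> 0.
Proof.
have -> : phi = fun x => normal_peak s * expR (- x ^+ 2 / (v *+ 2)).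
  by apply/funext => y; exact: phiE.
rewrite -(mulr0 (normal_peak s)); apply: cvgM; first exact: cvg_cst.
have e := @cvgr_expR R.
apply: (@squeeze_cvgr _ _ _ _ (fun=> 0) (fun x => expR (- (x / (v *+ 2))))).
- near=> x; have x1 : 1 <= x by near: x; exact: nbhs_pinfty_ge.
  rewrite expR_ge0 /= ler_expR mulNr lerN2 ler_wpM2r//.
    by rewrite invr_ge0 mulrn_wge0// ltW.
  by rewrite expr2 ler_peMl// (le_trans ler01).
- exact: cvg_cst.
- apply: (cvg_comp (fun x => x / (v *+ 2)) (fun y => expR (- y))) e.
  apply: gt0_cvgMly; last exact: cvg_id.
  by rewrite invr_gt0 mulrn_wgt0.
Unshelve. all: by end_near. Qed.

Let iphi : leb.-integrable setT (EFin \o phi).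
Proof. exact: integrable_normal_pdf. Qed.

Let mh : measurable_fun setT h.
Proof. by apply: continuous_measurable_fun; exact: ramp_continuous. Qed.

Let mphi : measurable_fun setT phi. Proof. exact: measurable_normal_pdf. Qed.

Let ihphi : leb.-integrable setT (EFin \o (fun x => h x * phi x)).
Proof.
apply: le_integrable iphi => //; first exact/measurable_EFinP/measurable_funM.
move=> x _ /=; rewrite lee_fin normrM ler_piMl//.
by rewrite ger0_norm ?ramp_ge0// ramp_le1.
Qed.

Let c := \int[leb]_x (h x * phi x).
Let k x := (h x - c) * phi x.

Let int_phi : \int[leb]_x phi x = 1.
Proof. by rewrite /Rintegral integral_normal_pdf. Qed.

Let prob_phi (A : set R) : fine (normal_prob 0 s A) = \int[leb]_(x in A) phi x.
Proof. by []. Qed.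

Let Rintegral_phi_mono (A : set R) (u : R -> R) : measurable A ->
  leb.-integrable setT (EFin \o u) -> (forall x, A x -> `|u x| <= phi x) ->
  `|\int[leb]_(x in A) u x| <= fine (normal_prob 0 s A).
Proof.
move=> mA iu uphi; rewrite prob_phi.
have iuA : leb.-integrable A (EFin \o u).
  exact: integrableS iu.
have ipA : leb.-integrable A (EFin \o phi).
  exact: integrableS iphi.
apply: (@le_trans _ _ (\int[leb]_(x in A) `|u x|)).
  exact: le_normr_Rintegral.
by apply: le_Rintegral => //; exact: integrable_norm.
Qed.

Lemma ramp_mean_ge : fine (normal_prob 0 s `]-oo, a]) <= c.
Proof.
have m : measurable `]-oo, a]%classic by exact: measurable_itv.
rewrite prob_phi Rintegral_mkcond; apply: le_Rintegral => //.
  rewrite -restrict_EFin.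
  apply: (@integrable_mkcond _ _ _ leb _ (EFin \o phi) m).1.
  exact: integrableS iphi.
move=> x _; rewrite patchE; case: ifPn.
  by rewrite inE /= in_itv /= => xa; rewrite /h ramp_left// mul1r.
by move=> _; rewrite mulr_ge0 ?ramp_ge0// ltW.
Qed.

Lemma ramp_mean_le : c <= fine (normal_prob 0 s `]-oo, b]).
Proof.
have m : measurable `]-oo, b]%classic by exact: measurable_itv.
rewrite prob_phi [leRHS]Rintegral_mkcond; apply: le_Rintegral => //.
  rewrite -restrict_EFin.
  apply: (@integrable_mkcond _ _ _ leb _ (EFin \o phi) m).1.
  exact: integrableS iphi.
move=> x _; rewrite patchE; case: ifPn.
  by move=> _; rewrite ler_piMl ?ramp_le1// ltW.
rewrite notin_setE /= in_itv /= => /negP; rewrite -ltNge => bx.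
by rewrite /h ramp_right ?mul0r// ltW.
Qed.

Let c_ge0 : 0 <= c.
Proof. by apply: Rintegral_ge0 => x _; rewrite mulr_ge0 ?ramp_ge0// ltW. Qed.

Let c_le1 : c <= 1.
Proof.
rewrite -int_phi; apply: le_Rintegral => // x _.
by rewrite ler_piMl ?ramp_le1// ltW.
Qed.

Let hc_le1 x : `|h x - c| <= 1.
Proof.
have := ramp_ge0 a b x; have := ramp_le1 a b x; rewrite -/h.
by have := c_ge0; have := c_le1; rewrite ler_norml => *; lra.
Qed.

Let k_le x : `|k x| <= phi x.
Proof. by rewrite normrM (ger0_norm (ltW (phi_gt0 x))) ler_piMl// ltW. Qed.

Let ik : leb.-integrable setT (EFin \o k).
Proof.
apply: le_integrable iphi => //.
  apply/measurable_EFinP; apply: measurable_funM => //.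
  exact: measurable_funB.
by move=> x _ /=; rewrite lee_fin (le_trans (k_le x))// ler_norm.
Qed.

Let int_k : \int[leb]_x k x = 0.
Proof.
transitivity (\int[leb]_x (h x * phi x - c * phi x)).
  by apply: eq_Rintegral => x _; rewrite /k mulrBl.
rewrite RintegralB//; last first.
  exact: (@integrableZl _ _ _ leb setT measurableT c (EFin \o phi)).
by rewrite RintegralZl// int_phi mulr1 subrr.
Qed.

Let F x := \int[leb]_(t in `]-oo, x]) k t.

Let k_cont : continuous k.
Proof.
move=> x; apply: cvgM; last exact: continuous_normal_pdf.
by apply: cvgB; [exact: ramp_continuous|exact: cvg_cst].
Qed.

Let dF x : is_derive x (1 : R) F (k x).
Proof.
have xx : x < x + 1 by rewrite ltrDl.
have ikx : leb.-integrable `]-oo, x + 1] (EFin \o k) by exact: integrableS ik.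
have [||dFx F'x] := @continuous_FTC1 R k -oo%O x _ xx ikx.
- exact: ltNyr.
- exact: k_cont.
by apply: DeriveDef; [exact: dFx|rewrite -derive1E; exact: F'x].
Qed.

Let F_left x : `|F x| <= fine (normal_prob 0 s `]-oo, x]).
Proof. exact: Rintegral_phi_mono. Qed.

(** The total integral of [k] vanishes: this is the choice of [c], and it makes
    the solution [f] bounded at [+oo] as well as at [-oo]. *)
Let F_right x : `|F x| <= fine (normal_prob 0 s `]x, +oo[).
Proof.
have -> : F x = - \int[leb]_(t in `]x, +oo[) k t.
  have := @Rintegral_itvB R k -oo%O +oo%O x.
  rewrite set_itvNyy => /(_ ik isT isT); rewrite int_k => <-.
  by rewrite sub0r opprK.
by rewrite normrN; exact: Rintegral_phi_mono.
Qed.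

Let idT : measurableTypeR R -> R := idfun.

#[local] HB.instance Definition _ :=
  @isMeasurableFun.Build _ _ _ _ idT (@measurable_id _ _ setT).

Let idR : {RV (normal_prob 0 s : probability (measurableTypeR R) R) >-> R} := idT.

Let F_cvgy : F x @[x --> +oo] --> 0.
Proof.
apply/norm_cvg0P.
have lim : fine (normal_prob 0 s `]x, +oo[) @[x --> +oo] --> 0.
  by apply: fine_cvg; exact: (cvg_ccdfy0 idR).
apply: (@squeeze_cvgr _ _ _ _ (fun=> 0) (fun x => fine (normal_prob 0 s `]x, +oo[))).
- by near=> x; rewrite normr_ge0 F_right.
- exact: cvg_cst.
- exact: lim.
Unshelve. all: by end_near. Qed.

Let F_cvgNy : F (- x) @[x --> +oo] --> 0.
Proof.
apply/norm_cvg0P.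
have lim : fine (normal_prob 0 s `]-oo, - x]) @[x --> +oo] --> 0.
  apply/(cvgNy_compNP (fun x => fine (normal_prob 0 s `]-oo, x])) _).
  by apply: fine_cvg; exact: (cvg_cdfNy0 idR).
apply: (@squeeze_cvgr _ _ _ _ (fun=> 0) (fun x => fine (normal_prob 0 s `]-oo, - x]))).
- by near=> x; rewrite normr_ge0 F_left.
- exact: cvg_cst.
- exact: lim.
Unshelve. all: by end_near. Qed.

(* Beyond [B] the ramp is constant and the Mills bounds apply. *)
Let B := 1 + `|a| + `|b|.

Let f x := F x / (v * phi x).
Let g x := (h x - c + x * f x) / v.
Let D x := f x + x * g x.

Let right_tail x : B < x -> [/\ 0 <= x * f x, x * f x <= c, 0 <= D x & D x <= c].
Proof.
move=> Bx; have bx y : B < y -> b <= y.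
  by move=> By; have := ler_norm b; have := normr_ge0 a; rewrite /B in By; lra.
have : [/\ 0 <= x * f x, x * f x <= c,
    0 <= f x + x * (x * f x - c) / v & f x + x * (x * f x - c) / v <= c].
  apply: (@mills_ratio _ phi v v_gt0 phi_gt0 dphi phi_cvg F B c) => //.
    by rewrite /B; have := normr_ge0 a; have := normr_ge0 b; lra.
  move=> y By; apply: is_derive_eq; first exact: dF.
  by rewrite /k /h ramp_right ?bx// sub0r.
suff -> : D x = f x + x * (x * f x - c) / v by [].
by rewrite /D /g /h ramp_right ?bx// sub0r -mulrA (addrC (- c)).
Qed.

(** Since [phi] is even, the reflection of [F] solves the right tail problem with
    mass [1 - c], the ramp being [1] on this side. *)
Let left_tail x : B < - x ->
  [/\ 0 <= - x * f x, - x * f x <= 1 - c, 0 <= D x & D x <= 1 - c].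
Proof.
move=> Bx; have ax y : B < y -> - y <= a.
  move=> By; have := ler_norm (- a); have := normr_ge0 b.
  by rewrite /B normrN in By *; lra.
have : [/\ 0 <= - x * (F (- - x) / (v * phi (- x))),
   - x * (F (- - x) / (v * phi (- x))) <= 1 - c,
   0 <= F (- - x) / (v * phi (- x)) + - x * (- x * (F (- - x) / (v * phi (- x))) - (1 - c)) / v
  & F (- - x) / (v * phi (- x)) + - x * (- x * (F (- - x) / (v * phi (- x))) - (1 - c)) / v <= 1 - c].
  apply: (@mills_ratio _ phi v v_gt0 phi_gt0 dphi phi_cvg (fun y => F (- y)) B (1 - c)) => //.
  - by rewrite /B; have := normr_ge0 a; have := normr_ge0 b; lra.
  - by rewrite subr_ge0.
  move=> y By; have dFy := dF (- y).
  have dN : is_derive y (1 : R) (fun y : R => - y) (- 1).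
    by apply: is_derive_eq.
  have dc := @is_derive1_comp R F (fun y : R => - y) y _ _ dFy dN.
  apply: (is_derive_eq dc).
  by rewrite /k /h ramp_left ?ax// phi_even; ring.
rewrite opprK phi_even -/(f x).
suff -> : D x = f x + - x * (- x * f x - (1 - c)) / v by [].
have xa : x <= a by rewrite -[x]opprK ax.
by rewrite /D /g /h ramp_left//; ring.
Qed.

Let df x : is_derive x (1 : R) f (g x).
Proof.
have vphi : v * phi x != 0 by rewrite gt_eqF// mulr_gt0.
have dFx := dF x; have dphix := dphi x.
have dinv : is_derive x (1 : R) (fun y => (v * phi y)^-1)
    (- (v * phi x) ^- 2 *: (v * (- (x / v) * phi x))).
  by apply: is_deriveV.
apply: is_derive_eq; rewrite /g /f /k /GRing.scale /=.
by field; rewrite !gt_eqF.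
Qed.

Let dxf x : is_derive x (1 : R) (fun x => x * f x) (D x).
Proof.
have dfx := df x.
by apply: is_derive_eq; rewrite /D /GRing.scale /=; ring.
Qed.

Let f_cont : continuous f.
Proof.
by move=> x; apply: differentiable_continuous; apply/derivable1_diffP; case: (df x).
Qed.

Let xf_cont : continuous (fun x : R => x * f x).
Proof. by move=> x; apply: cvgM; [exact: cvg_id|exact: f_cont]. Qed.

Let g_cont : continuous g.
Proof.
move=> x; apply: cvgM; last exact: cvg_cst.
apply: cvgD; last exact: xf_cont.
by apply: cvgB; [exact: ramp_continuous|exact: cvg_cst].
Qed.

Let D_cont : continuous D.
Proof.
move=> x; apply: cvgD; first exact: f_cont.
by apply: cvgM; [exact: cvg_id|exact: g_cont].
Qed.

Let tails x : B < `|x| -> `|x * f x| <= 1 /\ `|D x| <= 1.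
Proof.
have c0 := c_ge0; have c1 := c_le1.
rewrite lter_normr => /orP[/right_tail|/left_tail] [p0 pc D0 Dc].
  by rewrite !ger0_norm//; split; apply: le_trans c1.
rewrite -normrN -mulNr !ger0_norm//.
by split; [apply: (le_trans pc)|apply: (le_trans Dc)]; rewrite gerBl.
Qed.

(** With [c] the Gaussian mean of the ramp and [F] the integral of
    [(ramp - c) phi] up to [x], the function [f = F / (s^2 phi)] solves the
    equation. By the equation, both the bound on [f'] and its Lipschitz constant
    reduce to bounds on [x f] and on its derivative: these come from the Mills
    ratio far from the ramp and from continuity on the remaining segment. *)
Theorem stein_equation : exists f g : R -> R, exists L : R,
  [/\ forall x, is_derive x (1 : R) f (g x), forall x, `|g x| <= L,
      forall x y, `|g x - g y| <= L * `|x - y|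
    & forall x, s ^+ 2 * g x - x * f x = ramp a b x - c].
Proof.
have [K1 xf_le] := continuous_bounded_outside xf_cont (fun x Bx => (tails Bx).1).
have [K2 D_le] := continuous_bounded_outside D_cont (fun x Bx => (tails Bx).2).
have K10 : 0 <= K1 by exact: le_trans (xf_le 0).
have K20 : 0 <= K2 by exact: le_trans (D_le 0).
have ba0 : 0 <= (b - a)^-1 by rewrite invr_ge0 subr_ge0 ltW.
have v0 : 0 <= v^-1 by rewrite invr_ge0 ltW.
exists f, g, ((1 + K1 + ((b - a)^-1 + K2)) / v); split => //.
- move=> x; rewrite normrM (ger0_norm v0) ler_wpM2r//.
  apply: le_trans (ler_normD _ _) _.
  by have := hc_le1 x; have := xf_le x; lra.
- move=> x y; rewrite /g -mulrBl normrM (ger0_norm v0) mulrAC ler_wpM2r//.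
  have -> : h x - c + x * f x - (h y - c + y * f y) =
      (h x - h y) + (x * f x - y * f y) by ring.
  have lip : `|x * f x - y * f y| <= K2 * `|x - y|.
    wlog xy : x y / x <= y => [H|].
      by have [/H//|/ltW/H] := leP x y; rewrite (distrC (y * _)) (distrC y).
    have [||z _] := @MVT_segment R (fun x => x * f x) D x y xy.
    - by move=> z _; exact: dxf.
    - by apply: continuous_subspaceT; exact: xf_cont.
    by rewrite distrC => ->; rewrite normrM (distrC x) ler_wpM2r.
  apply: le_trans (ler_normD _ _) _.
  have := ramp_lip ab x y; rewrite -/h; have := normr_ge0 (x - y).
  move: lip; move: `|x - y| => t; rewrite !mulrDl mul1r.
  move=> ? ? ?; have : 0 <= K1 * t by rewrite mulr_ge0.
  lra.
- by move=> x; rewrite /g /h -/v; field; rewrite gt_eqF.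
Qed.

End SteinEquation.

(** * Convergence in distribution *)

Section Portmanteau.
Context {R : realType} (d : nat -> measure_display)
  (T : forall n, measurableType (d n)) (P : forall n, probability (T n) R).
Variables (X : forall n, T n -> R) (mu : probability (measurableTypeR R) R).
Arguments X : clear implicits.
Hypothesis mX : forall n, measurable_fun setT (X n).

Let mramp n a b : a < b -> measurable_fun setT (fun w => ramp a b (X n w)).
Proof.
move=> ab; apply: (@measurableT_comp _ _ _ _ _ _ (ramp a b) setT (X n)) => //.
by apply: continuous_measurable_fun; exact: ramp_continuous.
Qed.

Let iramp n a b : a < b -> integrable1 (P n) (fun w => ramp a b (X n w)).
Proof.
move=> ab; apply: integrable1_le (integrable1_cst (P n) 1) _; first exact: mramp.
by move=> w; rewrite ger0_norm ?ramp_ge0// ramp_le1.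
Qed.

Let mset n x : measurable (X n @^-1` `]-oo, x]).
Proof. by rewrite -[_ @^-1` _]setTI; apply: mX. Qed.

Let iset n x : integrable1 (P n) (\1_(X n @^-1` `]-oo, x])).
Proof. exact: integrable_indic. Qed.

Let mean_set n x : mean (P n) (\1_(X n @^-1` `]-oo, x])) =
  fine (P n (X n @^-1` `]-oo, x])).
Proof. by rewrite /mean expectation_indic. Qed.

Let cdf_le n a b : a < b -> fine (P n (X n @^-1` `]-oo, a])) <=
  mean (P n) (fun w => ramp a b (X n w)).
Proof.
move=> ab; rewrite -mean_set; apply: mean_le; [by []|exact: iramp|move=> w].
rewrite indicE; case: (boolP (w \in _)); last by rewrite ramp_ge0.
by rewrite inE /= in_itv /= => Xa; rewrite ramp_left.
Qed.

Let cdf_ge n a b : a < b -> mean (P n) (fun w => ramp a b (X n w)) <=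
  fine (P n (X n @^-1` `]-oo, b])).
Proof.
move=> ab; rewrite -mean_set; apply: mean_le; [exact: iramp|by []|move=> w].
rewrite indicE; case: (boolP (w \in _)); first by rewrite ramp_le1.
by rewrite notin_setE /= in_itv /= => /negP; rewrite -ltNge => Xb; rewrite ramp_right// ltW.
Qed.

(** Ramps squeeze the indicators of half-lines, so at a continuity point of the
    limit they determine the limit of the distribution functions. *)
Lemma cvg_in_distribution_ramp :
  (forall a b : R, a < b -> exists c : R,
    [/\ fine (mu `]-oo, a]%classic) <= c, c <= fine (mu `]-oo, b]%classic) &
       mean (P n) (fun w => ramp a b (X n w)) @[n --> \oo] --> c]) ->
  cvg_in_distribution P X mu.
Proof.
move=> ramps x cx.
pose M y := fine (mu `]-oo, y]%classic).
have MC : M y @[y --> x] --> M x by apply: fine_cvg; rewrite fineK ?fin_num_measure.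
rewrite -(@fineK _ (mu `]-oo, x]%classic)) ?fin_num_measure// -/(M x).
under eq_fun do rewrite -(@fineK _ (P _ _)) ?fin_num_measure//.
apply: cvg_EFin; first by near=> n.
apply/cvgrPdist_lt => e e0.
have e20 : 0 < e / 2 by rewrite divr_gt0.
have [dl /= dl0 Mdl] := (cvgrPdist_lt _ _).1 MC _ e20.
pose t := dl / 2.
have t0 : 0 < t by rewrite divr_gt0.
have Mr : `|M x - M (x + t)| < e / 2.
  apply: Mdl; rewrite /ball /= opprD addNKr normrN gtr0_norm// /t; lra.
have Ml : `|M x - M (x - t)| < e / 2.
  apply: Mdl; rewrite /ball /= opprB addrC subrK gtr0_norm// /t; lra.
have xr : x < x + t by rewrite ltrDl.
have xl : x - t < x by rewrite gtrBl.
have [cr [_ cr_le crC]] := ramps _ _ xr.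
have [cl [cl_ge _ clC]] := ramps _ _ xl.
have evr := (cvgrPdist_lt _ _).1 crC _ e20; have evl := (cvgrPdist_lt _ _).1 clC _ e20.
have := @filterI nat (nbhs \oo) eventually_filter _ _
  (evr eventually_filter) (evl eventually_filter).
apply: (@filterS nat (nbhs \oo) eventually_filter) => n /= [+ +].
have := cdf_le n xr; have := cdf_ge n xl; move: Mr Ml cr_le cl_ge.
rewrite -/(M (x + t)) -/(M (x - t)) !ltr_norml.
move: (M x) (M (x + t)) (M (x - t)) (mean _ _) (mean _ _) (fine _).
by move=> *; apply/andP; split; lra.
Unshelve. all: by end_near. Qed.

End Portmanteau.

(** * Central limit theorem under local dependence *)

(** The separation [3 r] of the last field is the one that holds when each [X k]
    looks at the sites from [k - r] to [k]: the product at [k] then sees the sites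
    from [k - 2 r] to [k + r]. *)
Record locally_dependent (d : measure_display) (T : measurableType d)
    (R : realType) (P : probability T R) (N r : nat) (X : 'I_N -> T -> R) :
    Prop := LocallyDependent {
  locdep_integrable4 : forall k, integrable4 P (X k);
  locdep_mean0 : forall k, mean P (X k) = 0;
  locdep_orth : forall k j, k != j -> mean P (fun w => X k w * X j w) = 0;
  locdep_far : forall k,
    independent P (X k) (fun w => \sum_(j | ~~ within r k j) X j w);
  locdep_far_pair : forall k j, ~~ within (3 * r) k j ->
    independent P (fun w => X k w * \sum_(i | within r k i) X i w)
                  (fun w => X j w * \sum_(i | within r j i) X i w) }.

(** Letting [n] go to infinity leaves [L * eps * (1 + s)], and [eps] is
    arbitrary. *)
Lemma cvg0_of_bound (R : realType) (x V t : nat -> R) (s L : R) :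
  0 <= L -> 0 <= s -> V n @[n --> \oo] --> s -> t n @[n --> \oo] --> 0 ->
  (forall eps n, 0 < eps ->
     `|x n| <= L * (eps + eps * V n + t n / eps) + L * `|s - V n|) ->
  x n @[n --> \oo] --> 0.
Proof.
move=> L0 s0 Vs t0 xle; apply/cvgrPdist_lt => e e0.
pose eps := e / 2 / ((L + 1) * (1 + s)).
have L1 : 0 < L + 1 by rewrite ltr_wpDl.
have s1 : 0 < 1 + s by rewrite ltr_pwDl.
have den0 : 0 < (L + 1) * (1 + s) by rewrite mulr_gt0.
have eps0 : 0 < eps by rewrite /eps !divr_gt0.
have lim : L * (eps + eps * V n + t n / eps) + L * `|s - V n| @[n --> \oo] -->
    L * (eps + eps * s + 0 / eps) + L * `|s - s|.
  apply: cvgD; apply: cvgM; first exact: cvg_cst.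
  - apply: cvgD; last by apply: cvgM => //; exact: cvg_cst.
    by apply: cvgD; [exact: cvg_cst|apply: cvgM => //; exact: cvg_cst].
  - exact: cvg_cst.
  - by apply: cvg_norm; apply: cvgB => //; exact: cvg_cst.
have lt_e : L * (eps + eps * s + 0 / eps) + L * `|s - s| < e.
  rewrite subrr normr0 mul0r mulr0 !addr0.
  have -> : eps + eps * s = e / 2 / (L + 1).
    by rewrite /eps; field; rewrite !gt_eqF.
  rewrite [L * _]mulrA ltr_pdivrMr//; have := mulr_ge0 L0 (ltW e0); lra.
have ev := cvgr_lt _ lim _ lt_e.
apply: (@filterS nat (nbhs \oo) eventually_filter) (ev eventually_filter) => n /=.
rewrite sub0r normrN.
exact: le_lt_trans (xle eps n eps0).
Qed.

Section CLT.
Context {R : realType} (d : nat -> measure_display)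
  (T : forall n, measurableType (d n)) (P : forall n, probability (T n) R).
Variables (N : nat -> nat) (r : nat) (X : forall n, 'I_(N n) -> T n -> R).
Arguments X : clear implicits.
Variables (kappa : nat -> R) (sigma2 : R).
Hypothesis kappa_ge0 : forall n, 0 <= kappa n.
Hypothesis X_dep : forall n, locally_dependent (P n) r (X n).
Hypothesis X4_le : forall n k, mean (P n) (fun w => X n k w ^+ 4) <= kappa n.
Hypothesis sigma2_ge0 : 0 <= sigma2.
Let W n w := \sum_k X n k w.
Let V n := mean (P n) (fun w => W w ^+ 2).
Hypothesis V_cvg : mean (P n) (fun w => (\sum_k X n k w) ^+ 2) @[n --> \oo] --> sigma2.
Hypothesis kappa_cvg : (N n)%:R * kappa n @[n --> \oo] --> 0.

Let W2 n : integrable2 (P n) (@W n).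
Proof.
apply: integrable2_sum => k _.
exact: integrable4_integrable2 (locdep_integrable4 (X_dep n) k).
Qed.

Let iW n (u : R -> R) (c : R) : continuous u -> (forall x, `|u x| <= c) ->
  integrable1 (P n) (fun w => u (W w)).
Proof.
move=> cu uc; apply: integrable1_le (integrable1_cst (P n) c) _ => //.
apply: (@measurableT_comp _ _ _ _ _ _ u setT (@W n)).
  exact: continuous_measurable_fun.
exact: (W2 n).1.
Qed.

Let ramp_norm (a b x : R) : `|ramp a b x| <= 1.
Proof. by rewrite ger0_norm ?ramp_ge0 ?ramp_le1. Qed.

(** A ramp is Lipschitz and the mean of [`|W|] is controlled by the second moment
    of [W], which here tends to [0]. *)
Let ramp_cvg_degenerate (a b : R) : a < b -> sigma2 = 0 ->
  mean (P n) (fun w => ramp a b (@W n w)) @[n --> \oo] --> ramp a b 0.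
Proof.
move=> ab s0; apply/subr_cvg0.
apply: (@cvg0_of_bound _ _ V V sigma2 (b - a)^-1) => //.
- by rewrite invr_ge0 subr_ge0 ltW.
- by rewrite -[X in _ --> X]s0.
move=> eps n e0.
rewrite /= -(mean_cst (P n) (ramp a b 0)) -meanB; last 2 first.
- exact: (iW n (ramp_continuous ab) (@ramp_norm a b)).
- exact: integrable1_cst.
have i2 := integrable1Z eps^-1 (W2 n).2.
have i3 := integrable1_cst (P n) eps.
have bound w : `|ramp a b (W w) - ramp a b 0| <=
    (b - a)^-1 * (2^-1 * (eps + eps^-1 * @W n w ^+ 2)).
  apply: le_trans (ramp_lip ab _ _) _; rewrite subr0.
  rewrite ler_wpM2l ?invr_ge0 ?subr_ge0 ?(ltW ab)//.
  have := young_le 1 `|@W n w| e0.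
  by rewrite mul1r expr1n mulr1 real_normK ?num_real.
apply: le_trans (norm_mean_le _ _ bound) _.
- apply: measurable_funB => //.
  exact: integrable1_measurable (iW n (ramp_continuous ab) (@ramp_norm a b)).
- by do 2 apply: integrable1Z; exact: integrable1D.
rewrite meanZ; last by apply: integrable1Z; exact: integrable1D.
rewrite meanZ; last exact: integrable1D.
rewrite meanD// mean_cst meanZ; last exact: (W2 n).2.
rewrite -/(V n) -[leLHS]addr0 lerD//; last first.
  by rewrite mulr_ge0// invr_ge0 subr_ge0 ltW.
rewrite ler_wpM2l ?invr_ge0 ?subr_ge0 ?(ltW ab)//.
have V0 : 0 <= V n by apply: mean_ge0 => w; exact: sqr_ge0.
have := mulr_ge0 (ltW e0) V0.
have : 0 <= eps^-1 * V n by rewrite mulr_ge0// invr_ge0 ltW.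
by rewrite (mulrC (V n)); move: (eps^-1 * _) (eps * _) => *; lra.
Qed.


(** The Stein equation turns the error into the mean of
    [sigma2 * g W - W * f W], which [stein_bound] controls up to the difference
    between [sigma2] and the variance of [W]. *)
Let ramp_cvg_gaussian (a b : R) : a < b -> sigma2 != 0 ->
  mean (P n) (fun w => ramp a b (@W n w)) @[n --> \oo] -->
  \int[lebesgue_measure]_x (ramp a b x * normal_pdf 0 (Num.sqrt sigma2) x).
Proof.
move=> ab s0.
set s := Num.sqrt sigma2.
have s_neq0 : s != 0 by rewrite sqrtr_eq0 -ltNge lt_neqAle eq_sym s0.
set c := (X in _ --> X).
have [f [g [L [fg gL gLip fgE]]]] := stein_equation s_neq0 ab.
rewrite sqr_sqrtr// -/c in fgE.
pose K := (6 * r + 2)%:R * (r.*2.+1)%:R ^+ 4 : R.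
apply/subr_cvg0.
apply: (@cvg0_of_bound _ _ V (fun n => (N n)%:R * kappa n * K) sigma2 L) => //.
- exact: le_trans (gL 0).
- by rewrite -[X in _ --> X](mul0r K); apply: cvgM => //; exact: cvg_cst.
move=> eps n e0.
have L0 : 0 <= L by exact: le_trans (gL 0).
have fc : continuous f.
  by move=> x; apply: differentiable_continuous; apply/derivable1_diffP; case: (fg x).
have ir := iW n (ramp_continuous ab) (@ramp_norm a b).
have ig := iW n (lipschitz_continuous gLip) gL.
have Wf : (fun w => @W n w * f (W w)) =
    (fun w => sigma2 * g (W w) - (ramp a b (W w) - c)).
  by apply/funext => w; have := fgE (W w); lra.
have mWf : mean (P n) (fun w => @W n w * f (W w)) =
    sigma2 * mean (P n) (fun w => g (@W n w)) -
    (mean (P n) (fun w => ramp a b (@W n w)) - c).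
  have ic := integrable1_cst (P n) c.
  rewrite Wf meanB; [|exact: integrable1Z|exact: integrable1B].
  by rewrite meanZ// meanB// mean_cst.
have stein := stein_bound (kappa_ge0 n) (locdep_integrable4 (X_dep n))
  (@X4_le n) (locdep_mean0 (X_dep n)) (@locdep_orth _ _ _ _ _ _ _ (X_dep n))
  (locdep_far (X_dep n)) (@locdep_far_pair _ _ _ _ _ _ _ (X_dep n))
  fg gL gLip e0.
have mg : `|mean (P n) (fun w => g (@W n w))| <= L.
  rewrite -[leRHS](mean_cst (P n)); apply: norm_mean_le => //.
  - exact: integrable1_measurable ig.
  - exact: integrable1_cst.
rewrite (_ : mean _ _ - c = (sigma2 - V n) * mean (P n) (fun w => g (@W n w)) -
    (mean (P n) (fun w => @W n w * f (W w)) -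
     V n * mean (P n) (fun w => g (@W n w)))); last by rewrite mWf; ring.
apply: le_trans (ler_normB _ _) _; rewrite addrC lerD//; last first.
  by rewrite normrM mulrC ler_wpM2r.
apply: le_trans stein _; rewrite le_eqVlt; apply/orP; left; apply/eqP.
by rewrite /K natrM /V /W; ring.
Qed.


(** By orthogonality the second moments of the summands add up to the variance,
    and the fourth moments add up to at most [N n * kappa n], which tends to [0].
    Every error term of [stein_bound] is a combination of these two sums. *)
Theorem clt_locally_dependent :
  cvg_in_distribution P (fun n w => \sum_k X n k w) (centered_gaussian sigma2).
Proof.
apply: (cvg_in_distribution_ramp (X := W)) => [n|a b ab]; first exact: (W2 n).1.
rewrite /centered_gaussian; case: eqVneq => [s0|s0].
  exists (ramp a b 0); split; last exact: ramp_cvg_degenerate.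
  - rewrite -[leLHS]/(fine (@dirac _ (measurableTypeR R) 0 R `]-oo, a]%classic)).
    rewrite diracE /=; case: (boolP (_ \in _)); last by rewrite ramp_ge0.
    by rewrite inE /= in_itv /= => a0; rewrite ramp_left.
  - rewrite -[leRHS]/(fine (@dirac _ (measurableTypeR R) 0 R `]-oo, b]%classic)).
    rewrite diracE /=; case: (boolP (_ \in _)); first by rewrite ramp_le1.
    rewrite notin_setE /= in_itv /= => /negP; rewrite -ltNge => b0.
    by rewrite ramp_right// ltW.
have s_neq0 : Num.sqrt sigma2 != 0.
  by rewrite sqrtr_eq0 -ltNge lt_neqAle eq_sym s0.
eexists; split; last exact: ramp_cvg_gaussian.
- exact: ramp_mean_ge.
- exact: ramp_mean_le.
Qed.

End CLT.

(** * Almost sure equality and conditional expectations *)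

Section AlmostSure.
Context {d : measure_display} {T : measurableType d} {R : realType}.
Variable P : probability T R.
Implicit Types X Y Z : T -> R.

Definition as_eq X Y := {ae P, forall w, X w = Y w}.

Lemma as_eq_trans Y X Z : as_eq X Y -> as_eq Y Z -> as_eq X Z.
Proof. by apply: filterS2 => w -> ->. Qed.

Lemma as_eqB X X' Y Y' : as_eq X X' -> as_eq Y Y' ->
  as_eq (fun w => X w - Y w) (fun w => X' w - Y' w).
Proof. by apply: filterS2 => w -> ->. Qed.

Lemma as_eq_sum (I : eqType) (s : seq I) (X Y : I -> T -> R) :
  (forall i, i \in s -> as_eq (X i) (Y i)) ->
  as_eq (fun w => \sum_(i <- s) X i w) (fun w => \sum_(i <- s) Y i w).
Proof.
elim: s => [_|i s IHs XY]; first by apply: aeW => w; rewrite !big_nil.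
have {}IHs := IHs (fun j js => XY j (mem_behead (s := i :: s) js)).
by apply: filterS2 (XY i (mem_head i s)) IHs => w e1 e2; rewrite !big_cons e1 e2.
Qed.

Lemma mean_as_eq X Y : measurable_fun setT X -> measurable_fun setT Y ->
  as_eq X Y -> mean P X = mean P Y.
Proof.
move=> mX mY XY; rewrite !meanE /Rintegral; congr fine.
apply: ae_eq_integral => //; try exact/measurable_EFinP.
by apply: filterS XY => w -> _.
Qed.

Lemma integral_norm_eq0 X : measurable_fun setT X ->
  (\int[P]_w `|(X w)%:E|)%E = 0%E -> as_eq X (fun=> 0).
Proof.
move=> mX X0; have mX' : measurable_fun setT (EFin \o X) by exact/measurable_EFinP.
have /ae_eq_integral_abs := X0 => /(_ measurableT mX').
by apply: filterS => w /= /(_ I) [].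
Qed.

Lemma mean_norm_eq0 X : integrable1 P X -> mean P (fun w => `|X w|) = 0 ->
  as_eq X (fun=> 0).
Proof.
move=> iX; rewrite meanE /Rintegral => X0.
apply: integral_norm_eq0; first exact: integrable1_measurable iX.
have fin := integrable_fin_num measurableT (integrable1_norm iX).
by rewrite -[LHS](fineK fin) X0.
Qed.

Lemma mean_indic_mul A X : measurable A -> integrable1 P X ->
  mean P (fun w => \1_A w * X w) = fine (\int[P]_(w in A) (X w)%:E).
Proof.
move=> mA iX; rewrite meanE -/(Rintegral P A X) [RHS]Rintegral_mkcond.
apply: eq_Rintegral => w _; rewrite patchE indicE.
by case: ifP; rewrite ?mul1r ?mul0r.
Qed.

Lemma integrable1_indic_mul A X : measurable A -> integrable1 P X ->
  integrable1 P (fun w => \1_A w * X w).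
Proof.
move=> mA iX; apply: integrable1_le (integrable1_norm iX) _.
  by apply: measurable_funM => //; exact: integrable1_measurable iX.
by move=> w; rewrite normrM indicE ler_piMl//; case: (_ \in _); rewrite ?normr1 ?normr0.
Qed.

(** A mean zero factor, independent of the other one, cancels a product as soon
    as the product is integrable: if the first factor is not integrable, then
    the second one vanishes almost surely. *)
Lemma mean_independentM_eq0 X Y : measurable_fun setT X -> integrable1 P Y ->
  independent P X Y -> mean P Y = 0 -> integrable1 P (fun w => X w * Y w) ->
  mean P (fun w => X w * Y w) = 0.
Proof.
move=> mX iY XY Y0 iXY; have mY := integrable1_measurable iY.
have [Yz|Ynz] := eqVneq (\int[P]_w `|(Y w)%:E|)%E 0%E.
  rewrite (mean_as_eq (Y := fun=> 0)) ?mean_cst//; first exact: measurable_funM.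
  by apply: filterS (integral_norm_eq0 mY Yz) => w ->; rewrite mulr0.
suff iX : integrable1 P X by rewrite mean_independentM// Y0 mulr0.
apply/integrableP; split; first exact/measurable_EFinP.
rewrite ltey; apply/eqP => Xoo.
case/integrableP : iXY => _; rewrite /= (integral_norm_independentM mX mY XY) Xoo.
rewrite gt0_mulye ?ltxx// lt_neqAle eq_sym Ynz.
exact: integral_ge0.
Qed.

End AlmostSure.

Section CondExp.
Context {d : measure_display} {T : measurableType d} {R : realType}.
Context {P : probability T R}.
Variables (I : finType) (V : I -> {RV P >-> R}).
Implicit Types (D : {set I}) (X Y Z : T -> R).

(** The mean of [`|Y - Z|] is the integral of [Y - Z] over the event where it is
    nonnegative, minus the one over the complement; both events belong to the
    conditioning sigma-algebra. *)
Lemma condexp_version_unique D X Y Z : is_condexp P <<s block V D >> X Y ->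
  is_condexp P <<s block V D >> X Z -> as_eq P Y Z.
Proof.
move=> [aY iY eY] [aZ iZ eZ].
have adapt U : g_sigma_algebra_preimage U `<=` <<s block V D >> -> adapted V D U.
  by move=> aU _ B mB; apply: aU; exists B.
have aYZ := adaptedB (adapt _ aY) (adapt _ aZ).
have iYZ : integrable1 P (fun w => Y w - Z w) by exact: integrable1B.
have zero A : <<s block V D >> A -> mean P (fun w => \1_A w * (Y w - Z w)) = 0.
  move=> DA; have mA := sigma_block_measurable DA.
  rewrite (mean_ext P (Y := fun w => \1_A w * Y w - \1_A w * Z w)); last first.
    by move=> w; rewrite mulrBr.
  rewrite meanB; try exact: integrable1_indic_mul.
  by rewrite !mean_indic_mul// eY// eZ// subrr.
pose A := [set w | 0 <= Y w - Z w].
have DA : <<s block V D >> A.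
  have -> : A = setT `&` (fun w => Y w - Z w) @^-1` `[0, +oo[.
    by rewrite setTI; apply/seteqP; split => w /=; rewrite in_itv /= andbT.
  exact: aYZ measurableT _ (measurable_itv _).
have DcA : <<s block V D >> (~` A).
  exact: (@measurableC _ (g_sigma_algebraType (block V D)) A DA).
suff YZ0 : as_eq P (fun w => Y w - Z w) (fun=> 0).
  by apply: filterS YZ0 => w /eqP; rewrite subr_eq0 => /eqP.
apply: mean_norm_eq0 => //.
rewrite (mean_ext P (Y := fun w => \1_A w * (Y w - Z w) -
    \1_(~` A) w * (Y w - Z w))); last first.
  move=> w; rewrite indicC !indicE.
  case: (boolP (w \in A)) => [|]; rewrite ?inE ?notin_setE /A /= => Aw.
    by rewrite ger0_norm//; ring.
  by rewrite ltr0_norm ?ltNge; [ring|exact/negP].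
by rewrite meanB ?zero ?subrr//; apply: integrable1_indic_mul => //;
  [exact: (sigma_block_measurable DA)|exact: (sigma_block_measurable DcA)].
Qed.

(** Also valid when no version exists, the chosen value being then constant. *)
Lemma measurable_condexp D X :
  measurable_fun setT (condexp P <<s block V D >> X).
Proof.
rewrite /condexp; case: xgetP => [Y _ [aY _ _]|_]; last exact: measurable_cst.
by move=> _ B mB; apply: sigma_block_measurable; apply: aY; exists B.
Qed.

Lemma condexp_as_eq D X Y : is_condexp P <<s block V D >> X Y ->
  as_eq P (condexp P <<s block V D >> X) Y.
Proof.
move=> XY; apply: (condexp_version_unique _ XY).
by apply: (xgetPex (cst 0)); exists Y.
Qed.

(** A factor that is known can be pulled out of a conditional expectation, and
    an independent one is replaced by its mean. *)
Lemma is_condexp_independentM D X Y : adapted V D X ->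
  (forall A, <<s block V D >> A -> independent P (fun w => \1_A w * X w) Y) ->
  integrable1 P X -> integrable1 P Y ->
  is_condexp P <<s block V D >> (fun w => X w * Y w) (fun w => X w * mean P Y).
Proof.
move=> aX XY iX iY.
have iXc : integrable1 P (fun w => X w * mean P Y).
  by apply: integrable1_ext (integrable1Z (mean P Y) iX) => w; rewrite mulrC.
have mX := adapted_measurable aX; have mY := integrable1_measurable iY.
have XYT : independent P X Y.
  have -> : X = (fun w => \1_(setT : set T) w * X w).
    by apply/funext => w; rewrite indicT mul1r.
  apply: XY; exact: (@measurableT _ (g_sigma_algebraType (block V D))).
have iXY := independent_integrable1M mX mY XYT iX iY.
split => //.
- move=> _ [B mB <-].
  have aXc := adaptedM aX (adapted_cst (mean P Y)).
  exact: (aXc measurableT B mB).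
- move=> A DA; have mA := sigma_block_measurable DA.
  have fin Z : integrable1 P Z -> (\int[P]_(w in A) (Z w)%:E)%E \is a fin_num.
    by move=> iZ; apply: integrable_fin_num => //; exact: integrableS iZ.
  rewrite -(fineK (fin _ iXc)) -(fineK (fin _ iXY)) -!mean_indic_mul//.
  congr EFin; have iAX := integrable1_indic_mul mA iX.
  rewrite (mean_ext P (Y := fun w => mean P Y * (\1_A w * X w))); last first.
    by move=> w; ring.
  rewrite meanZ// mulrC -mean_independentM//; [|exact: integrable1_measurable iAX|exact: XY].
  by apply: mean_ext => w; rewrite mulrA.
Qed.

End CondExp.

(** * Martingale differences of a product of independent factors *)

Section Factorized.
Context {d : measure_display} {T : measurableType d} {R : realType}.
Context {P : probability T R}.
Variables (I : finType) (V : I -> {RV P >-> R}).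
Hypothesis indep : mutually_independent V.
Variables (N : nat) (site : I -> nat).

Definition sites (Q : pred nat) : {set I} := [set x | Q (site x)]%SET.

Lemma sitesS (Q Q' : pred nat) : (forall i, Q i -> Q' i) ->
  sites Q \subset sites Q'.
Proof. by move=> QQ'; apply/fintype.subsetP => x; rewrite !inE; exact: QQ'. Qed.

Lemma sites_disjoint (Q Q' : pred nat) : (forall i, Q i -> ~~ Q' i) ->
  forall x, x \in sites Q -> x \notin sites Q'.
Proof. by move=> QQ' x; rewrite !inE; exact: QQ'. Qed.

Lemma adapted_sites_independent (Q Q' : pred nat) (X Y : T -> R) :
  (forall i, Q i -> ~~ Q' i) -> adapted V (sites Q) X ->
  adapted V (sites Q') Y -> independent P X Y.
Proof. by move=> QQ'; apply: adapted_independent => //; exact: sites_disjoint. Qed.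

Variables (m : nat) (Z : 'I_N -> T -> R) (S : pred 'I_N).
Hypothesis aZ : forall k, adapted V (sites (pred1 (val k))) (Z k).
Hypothesis Z_untouched : forall k w, ~~ S k -> Z k w = 1.
Hypothesis S_span : forall i j, S i -> S j -> (i <= j + m)%N.

Let xi w := \prod_k Z k w.
Hypothesis ixi : integrable1 P xi.

Let past k := sites (fun i => (i < k)%N).
Let F k := <<s block V (past k) >>.

Let mZ k : measurable_fun setT (Z k).
Proof. exact: adapted_measurable (@aZ k). Qed.

Let mxi : measurable_fun setT xi. Proof. exact: integrable1_measurable ixi. Qed.

Let adapted_prodZ (p : pred 'I_N) (Q : pred nat) :
  (forall i : 'I_N, p i -> Q i) ->
  adapted V (sites Q) (fun w => \prod_(i | p i) Z i w).
Proof.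
move=> pQ; apply: adapted_prod => i pi; apply: adaptedS (@aZ i).
by apply: sitesS => j /eqP ->; exact: pQ.
Qed.

(** The mean of [`|xi|] is the mean of [`|Z k|] times the mean of the absolute
    value of the other factors, and the latter is positive unless [xi] vanishes
    almost surely. *)
Let factors_integrable : ~ as_eq P xi (fun=> 0) -> forall k, integrable1 P (Z k).
Proof.
move=> xi_neq0 k; apply/integrableP; split; first exact/measurable_EFinP.
pose Y w := \prod_(i | i != k) Z i w.
have aY : adapted V (sites (fun i => i != k)) Y by exact: adapted_prodZ.
have mY := adapted_measurable aY.
have ZY : independent P (Z k) Y.
  by apply: (adapted_sites_independent _ (@aZ k) aY) => i /eqP ->; rewrite eqxx.
have xiE : xi = (fun w => Z k w * Y w).
  by apply/funext => w; rewrite /xi (bigD1 k).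
rewrite ltey; apply/eqP => Zoo.
case/integrableP : ixi => _; rewrite xiE /=.
rewrite (integral_norm_independentM (mZ k) mY ZY).
have [Y0|Y0] := eqVneq (\int[P]_w `|(Y w)%:E|)%E 0%E.
  case: xi_neq0; rewrite xiE.
  by apply: filterS (integral_norm_eq0 mY Y0) => w ->; rewrite mulr0.
rewrite [X in (X * _)%E]Zoo gt0_mulye ?ltxx// lt_neqAle eq_sym Y0.
exact: integral_ge0.
Qed.

Section nonzero.
Hypothesis iZ : forall k, integrable1 P (Z k).
Let e k := mean P (Z k).

Let prodZ_seq (s : seq 'I_N) : uniq s ->
  integrable1 P (fun w => \prod_(i <- s) Z i w) /\
  mean P (fun w => \prod_(i <- s) Z i w) = \prod_(i <- s) e i.
Proof.
elim: s => [_|i s IHs /= /andP[i_s /IHs[ints means]]].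
  by under eq_fun do rewrite big_nil; rewrite big_nil mean_cst; split => //;
    exact: integrable1_cst.
under eq_fun do rewrite big_cons; rewrite big_cons.
have as_ : adapted V (sites (fun j => j \in map val s)) (fun w => \prod_(j <- s) Z j w).
  have -> : (fun w => \prod_(j <- s) Z j w) = (fun w => \prod_(j <- s | j \in s) Z j w).
    by apply/funext => w; rewrite big_seq.
  apply: adapted_prod => j js; apply: adaptedS (@aZ j).
  by apply: sitesS => k /eqP ->; exact: map_f.
have ind : independent P (Z i) (fun w => \prod_(j <- s) Z j w).
  apply: (adapted_sites_independent _ (@aZ i) as_) => j /eqP ->.
  by rewrite mem_map//; exact: val_inj.
have ms_ := adapted_measurable as_.
split; first exact: independent_integrable1M.
by rewrite mean_independentM// means.
Qed.

Let prodZ (p : pred 'I_N) : integrable1 P (fun w => \prod_(i | p i) Z i w) /\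
  mean P (fun w => \prod_(i | p i) Z i w) = \prod_(i | p i) e i.
Proof.
have := prodZ_seq (enum_uniq p); rewrite big_enum.
by have -> : (fun w => \prod_(i <- enum p) Z i w) = (fun w => \prod_(i | p i) Z i w)
  by apply/funext => w; rewrite big_enum.
Qed.

Let A (k : nat) w := \prod_(i < N | (i < k)%N) Z i w.
Let B (k : nat) w := \prod_(i < N | ~~ (i < k)%N) Z i w.
Let tail (k : nat) := \prod_(i < N | ~~ (i < k)%N) e i.
Let M k w := A k w * tail k.
Let D (k : 'I_N) w := A k w * (Z k w - e k) * tail k.+1.

Let A_past k : adapted V (past k) (A k). Proof. exact: adapted_prodZ. Qed.

Let xi_AB k : xi = (fun w => A k w * B k w).
Proof. by apply/funext => w; rewrite /xi (bigID (fun i : 'I_N => (i < k)%N)). Qed.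

(** Splitting the product at [k], the first factors are known and the others are
    independent of the past. *)
Let M_condexp k : as_eq P (condexp P (F k) xi) (M k).
Proof.
apply: condexp_as_eq; rewrite (xi_AB k) /M /tail -(prodZ _).2.
apply: is_condexp_independentM; [exact: A_past| |exact: (prodZ _).1..].
move=> E FE; have aB : adapted V (sites (fun i => ~~ (i < k)%N)) (B k).
  exact: adapted_prodZ.
apply: (adapted_sites_independent _ _ aB); last first.
  exact: adaptedM (adapted_indic FE) (@A_past k).
by move=> i ik; rewrite negbK.
Qed.

Let D_diff (k : 'I_N) w : D k w = M k.+1 w - M k w.
Proof.
have -> : M k.+1 w = Z k w * A k w * tail k.+1.
  rewrite /M /A (bigD1 k) ?ltnS//=; congr (_ * _ * _); apply: eq_bigl => i.
  by rewrite ltnS ltn_neqAle andbC.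
have -> : M k w = A k w * (e k * tail k.+1).
  rewrite /M /tail (bigD1 k) ?ltnn//=; congr (_ * (_ * _)); apply: eq_bigl => i.
  by rewrite -!leqNgt ltn_neqAle andbC eq_sym.
by rewrite /D; ring.
Qed.

Let D_untouched k w : ~~ S k -> D k w = 0.
Proof.
move=> kS; rewrite /D /e (mean_ext P (fun w => Z_untouched w kS)) mean_cst.
by rewrite Z_untouched// subrr mulr0 mul0r.
Qed.

(** The factors of sites more than [m] below a touched site are equal to [1], and
    an untouched site contributes nothing. *)
Let D_window (k : 'I_N) : adapted V (sites (fun i => (k <= i + m)%N && (i <= k)%N)) (D k).
Proof.
have [kS|kS] := boolP (S k); last first.
  have -> : D k = (fun=> 0) by apply/funext => w; exact: D_untouched.
  exact: adapted_cst.
have -> : D k = (fun w => (\prod_(i < N | (i < k)%N && (k <= i + m)%N) Z i w) *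
    (Z k w - e k) * tail k.+1).
  apply/funext => w; congr (_ * _ * _); rewrite /A.
  rewrite (bigID (fun i : 'I_N => (k <= i + m)%N)) /= [X in _ * X]big1 ?mulr1//.
  move=> i /andP[_ ki]; apply: Z_untouched; apply: contra ki => iS.
  exact: S_span.
apply: adaptedM; last exact: adapted_cst.
apply: adaptedM; first by apply: adapted_prodZ => i /andP[ik ki]; rewrite ki ltnW.
apply: adaptedB; last exact: adapted_cst.
by apply: adaptedS (@aZ k); apply: sitesS => i /eqP ->; rewrite leq_addr leqnn.
Qed.

Let D_orth (k : 'I_N) Y : adapted V (past k) Y -> integrable1 P (fun w => Y w * D k w) ->
  mean P (fun w => Y w * D k w) = 0.
Proof.
move=> aY.
have YDE : (fun w => Y w * D k w) =
    (fun w => (Y w * A k w * tail k.+1) * (Z k w - e k)).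
  by apply/funext => w; rewrite /D; ring.
have aYA := adaptedM (adaptedM aY (@A_past k)) (adapted_cst (tail k.+1)).
have iZe : integrable1 P (fun w => Z k w - e k).
  by apply: integrable1B => //; exact: integrable1_cst.
rewrite YDE; apply: mean_independentM_eq0 => //.
- exact: adapted_measurable aYA.
- apply: (adapted_sites_independent _ aYA (adaptedB (@aZ k) (adapted_cst (e k)))).
  by move=> i /= ik; rewrite neq_ltn ik.
- by rewrite meanB// ?mean_cst ?subrr//; exact: integrable1_cst.
Qed.

Let sum_D w : \sum_k D k w = xi w - mean P xi.
Proof.
under eq_bigr do rewrite D_diff.
rewrite -(big_mkord xpredT (fun k => M k.+1 w - M k w)) telescope_sumr//.
have -> : mean P xi = \prod_k e k := (prodZ xpredT).2.
rewrite /M /A /tail; congr (_ - _).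
  rewrite [X in _ * X]big_pred0 ?mulr1; last by move=> i; rewrite ltn_ord.
  by rewrite /xi; apply: eq_bigl => i; rewrite ltn_ord.
by rewrite [X in X * _]big_pred0 // mul1r; apply: eq_bigl => i; rewrite ltn0.
Qed.

Lemma martingale_decomposition_nonzero : exists D : 'I_N -> T -> R,
  [/\ forall k : 'I_N, adapted V (sites (fun i => (k <= i + m)%N && (i <= k)%N)) (D k),
      forall k w, ~~ S k -> D k w = 0,
      as_eq P (fun w => \sum_k D k w) (fun w => xi w - mean P xi),
      forall (k : 'I_N) Y, adapted V (past k) Y -> integrable1 P (fun w => Y w * D k w) ->
        mean P (fun w => Y w * D k w) = 0
    & forall k : 'I_N, as_eq P
        (fun w => condexp P (F k.+1) xi w - condexp P (F k) xi w) (D k)].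
Proof.
exists D; split => //; first by apply: aeW => w; exact: sum_D.
move=> k; apply: (as_eq_trans (Y := fun w => M k.+1 w - M k w)).
  by apply: as_eqB; exact: M_condexp.
by apply: aeW => w; rewrite D_diff.
Qed.

End nonzero.

(** For a product that is not almost surely zero, the conditional expectation
    given the first [k] sites is the product of the first [k] factors and of the
    means of the others. Consecutive differences then only see the factors of the
    sites up to [k], and those too far from [k] equal [1]. *)
Theorem martingale_decomposition : exists D : 'I_N -> T -> R,
  [/\ forall k : 'I_N, adapted V (sites (fun i => (k <= i + m)%N && (i <= k)%N)) (D k),
      forall k w, ~~ S k -> D k w = 0,
      as_eq P (fun w => \sum_k D k w) (fun w => xi w - mean P xi),
      forall (k : 'I_N) Y, adapted V (past k) Y -> integrable1 P (fun w => Y w * D k w) ->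
        mean P (fun w => Y w * D k w) = 0
    & forall k : 'I_N, as_eq P
        (fun w => condexp P (F k.+1) xi w - condexp P (F k) xi w) (D k)].
Proof.
have [xi0|xi_neq0] := pselect (as_eq P xi (fun=> 0)); last first.
  exact/martingale_decomposition_nonzero/factors_integrable.
have mean0 : mean P xi = 0 by rewrite (mean_as_eq mxi _ xi0) ?mean_cst.
exists (fun _ _ => 0); split => //.
- by move=> k; exact: adapted_cst.
- by apply: filterS xi0 => w ->; rewrite big1// mean0 subrr.
- by move=> k Y _ _; under eq_fun do rewrite mulr0; rewrite mean_cst.
move=> k.
have cond0 j : as_eq P (condexp P (F j) xi) (fun=> 0).
  apply: condexp_as_eq; split.
  - have a0 : adapted V (past j) (fun=> 0) by exact: adapted_cst.
    by move=> _ [E mE <-]; exact: (a0 measurableT E mE).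
  - exact: integrable1_cst.
  - move=> E FE; have mE := sigma_block_measurable FE.
    apply: ae_eq_integral => //.
      by apply/measurable_EFinP; exact: measurable_funS mxi.
    by apply: filterS xi0 => w -> _.
apply: (as_eq_trans (Y := fun w => 0 - 0)); first exact: as_eqB.
by apply: aeW => w; rewrite subrr.
Qed.

End Factorized.

(** * Closed paths and traces of powers *)

Section Paths.
Variable N : nat.
Implicit Types (i j : 'I_N) (s : seq 'I_N).

Lemma adjacent_within i j : adjacent i j = within 1 i j.
Proof. by rewrite /adjacent /within !addn1. Qed.

Lemma path_within i s j : path (@adjacent N) i s -> j \in i :: s ->
  within (size s) i j.
Proof.
elim: s i => [|x s IHs] i /=.
  by rewrite inE => _ /eqP ->; exact: within_refl.
move=> /andP[ix xs]; rewrite inE => /predU1P[->|/(IHs _ xs)]; first exact: within_refl.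
by move: ix; rewrite /adjacent /within => /andP[? ?] /andP[? ?]; lia.
Qed.

Fixpoint paths r i : seq (seq 'I_N) :=
  if r is r'.+1 then [seq j :: s | j <- enum (adjacent i), s <- paths r' j]
  else [:: [::]].

Lemma mem_paths r i s : s \in paths r i -> path (@adjacent N) i s /\ size s = r.
Proof.
elim: r i s => [|r IHr] i s /=; first by rewrite inE => /eqP ->.
move=> /allpairsPdep[j [t [+ /IHr[jt <-] ->]]] /=.
by rewrite mem_enum => ij; split => //; rewrite jt andbT.
Qed.

(** A site has at most three neighbours, itself included. *)
Lemma size_paths r i : (size (paths r i) <= 3 ^ r)%N.
Proof.
elim: r i => [//|r IHr] i /=; rewrite size_allpairs_dep expnS.
apply: (@leq_trans (\sum_(j <- enum (adjacent i)) 3 ^ r)%N).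
  by rewrite sumnE big_map; apply: leq_sum => j _; exact: IHr.
rewrite big_const_seq count_predT iter_addn_0 mulnC leq_mul2r.
apply/orP; right; rewrite (eq_enum (adjacent_within i)).
exact: (size_within 1 i).
Qed.

Lemma path_weight_cons (R : realType) (J : 'M[R]_N) i j s :
  path_weight J (i, j :: s) = J i j * path_weight J (j, s).
Proof. by rewrite /path_weight /= big_cons. Qed.

(** Grouped by starting point, so that the paths that matter for a given site can
    be selected by their starting point alone. Lengths are strictly below [m], as
    exponents are below the size of a polynomial. *)
Definition closed_paths m i : seq (seq 'I_N) :=
  flatten [seq [seq s <- paths r i | last i s == i] | r <- iota 0 m].

Lemma mem_closed_paths m i s : s \in closed_paths m.+1 i ->
  admissible_paths m (i, s).
Proof.
move=> /flatten_mapP[r]; rewrite mem_iota => rm.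
rewrite mem_filter => /andP[/eqP si /mem_paths[pis sr]].
by split => //=; rewrite sr; lia.
Qed.

Lemma size_closed_paths m i : (size (closed_paths m i) <= m * 3 ^ m)%N.
Proof.
rewrite size_flatten /shape -map_comp sumnE big_map.
apply: (@leq_trans (\sum_(r <- iota 0 m) 3 ^ m)%N); last first.
  by rewrite big_const_seq count_predT size_iota iter_addn_0 mulnC.
rewrite big_seq [leqRHS]big_seq; apply: leq_sum => r; rewrite mem_iota => rm.
rewrite /= size_filter (leq_trans (count_size _ _))// (leq_trans (size_paths r i))//.
by rewrite leq_exp2l//; lia.
Qed.

End Paths.

Section TracePower.
Context {R : realType}.
Variables (n : nat) (J : 'M[R]_n.+1).
Hypothesis J_tridiag : forall i j, ~~ adjacent i j -> J i j = 0.

Lemma expr_tridiagonal r i j : (J ^+ r) i j =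
  \sum_(s <- paths r i | last i s == j) path_weight J (i, s).
Proof.
elim: r i => [|r IHr] i.
  rewrite expr0 /= big_mkcond big_seq1 /= mxE /path_weight big_nil.
  by case: (i == j).
rewrite exprS mxE [paths _ _]/= [RHS]big_mkcond big_allpairs_dep /= big_enum /=.
rewrite (bigID (adjacent i)) /= [X in _ + X]big1 ?addr0; last first.
  by move=> l /J_tridiag ->; rewrite mul0r.
apply: eq_bigr => l _; rewrite IHr mulr_sumr big_mkcond /=; apply: eq_bigr => s _.
by case: ifP => //; rewrite path_weight_cons.
Qed.

Lemma trace_horner_paths (p : {poly R}) :
  \tr (horner_mx J p) = \sum_i \sum_(s <- closed_paths (size p) i)
    p`_(size s) * path_weight J (i, s).
Proof.
have -> : horner_mx J p = \sum_(r < size p) p`_r *: J ^+ r.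
  rewrite -[p in LHS]coefK poly_def raddf_sum; apply: eq_bigr => r _.
  by rewrite [LHS]horner_mxZ rmorphXn /= horner_mx_X.
rewrite /mxtrace; apply: eq_bigr => i _.
rewrite summxE /closed_paths big_flatten big_map -(big_mkord xpredT (fun r => (p`_r *: J ^+ r) i i)).
rewrite /index_iota subn0; apply: eq_bigr => r _.
rewrite mxE expr_tridiagonal mulr_sumr big_filter big_seq_cond [RHS]big_seq_cond.
by apply: eq_bigr => s /andP[/mem_paths[_ ->] _].
Qed.

End TracePower.

(** * Martingale differences of path weights *)

Lemma mem_zip (S U : eqType) (s : seq S) (t : seq U) x y :
  (x, y) \in zip s t -> x \in s /\ y \in t.
Proof.
elim: s t => [|x' s IHs] [|y' t]//=; rewrite !inE => /predU1P[[-> ->]|/IHs[-> ->]].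
  by rewrite !eqxx.
by rewrite !orbT.
Qed.

Section JacobiPaths.
Context {d : measure_display} {T : measurableType d} {R : realType}.
Context {P : probability T R}.
Variables (n : nat) (a b : nat -> {RV P >-> R}).
Notation N := n.+1.
Notation V := (@entries _ _ _ P N a b).

Definition entry_site (x : 'I_N + 'I_N.-1) : nat :=
  match x with inl i => i | inr i => i end.

Notation window Q := (sites entry_site Q).

Lemma filtration_sites k : (k <= N)%N ->
  filtration N a b k = <<s block V (window (fun i => (i < k)%N)) >>.
Proof.
move=> kN; rewrite /filtration; congr (<<s _ >>).
apply/seteqP; split => A.
  move=> [[i /= ik Ai]|[i /= ik Ai]].
    by exists (inl (Ordinal (leq_trans ik kN))); rewrite //= inE.
  have [ik' iN] : (i < k)%N /\ (i < N.-1)%N by move: ik; rewrite leq_min => /andP[].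
  by exists (inr (Ordinal iN)); rewrite //= inE.
move=> [[i|i] /=]; rewrite inE /= => ik Ai; [left|right]; exists (val i) => //=.
by rewrite leq_min ik /=.
Qed.

Lemma jacobi_tridiag w (i j : 'I_N) : ~~ adjacent i j -> jacobi N a b w i j = 0.
Proof.
rewrite /adjacent mxE => nij; case: ifP => [/eqP ji|_].
  by move: nij; rewrite ji leqnSn.
case: ifP => [/eqP ji|_]; first by move: nij; rewrite ji; lia.
by case: ifP => [/eqP ji|//]; move: nij; rewrite ji; lia.
Qed.

Lemma adapted_jacobi (i j : 'I_N) :
  adapted V (window (pred1 (minn i j))) (fun w => jacobi N a b w i j).
Proof.
have [ij|nij] := eqVneq j i.
  rewrite ij minnn; have -> : (fun w => jacobi N a b w i i) = V (inl i).
    by apply/funext => w; rewrite mxE eqxx.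
  by apply: adapted_var; rewrite inE /=.
have [ij|nij1] := eqVneq (j : nat) i.+1.
  have iN : (i < N.-1)%N by have := ltn_ord j; rewrite ij.
  have -> : (fun w => jacobi N a b w i j) = V (inr (Ordinal iN)).
    by apply/funext => w; rewrite mxE (negbTE nij) ij eqxx.
  by apply: adapted_var; rewrite inE /= ij; lia.
have [ij|nij2] := eqVneq (i : nat) j.+1.
  have jN : (j < N.-1)%N by have := ltn_ord i; rewrite ij.
  have -> : (fun w => jacobi N a b w i j) = V (inr (Ordinal jN)).
    by apply/funext => w; rewrite mxE (negbTE nij) (negbTE nij1) ij eqxx.
  by apply: adapted_var; rewrite inE /= ij; lia.
have -> : (fun w => jacobi N a b w i j) = (fun=> 0).
  by apply/funext => w; rewrite mxE (negbTE nij) (negbTE nij1) (negbTE nij2).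
exact: adapted_cst.
Qed.

Definition path_edges (u : 'I_N * seq 'I_N) := zip (u.1 :: u.2) u.2.

(** An edge of a path is attached to its lower endpoint, whose site holds the
    corresponding matrix entry. *)
Definition site_factor (u : 'I_N * seq 'I_N) (k : 'I_N) (w : T) : R :=
  \prod_(e <- path_edges u | minn e.1 e.2 == k) jacobi N a b w e.1 e.2.

Definition touches (u : 'I_N * seq 'I_N) (k : 'I_N) :=
  has (fun e : 'I_N * 'I_N => minn e.1 e.2 == k) (path_edges u).

Lemma path_weight_sites u w :
  path_weight (jacobi N a b w) u = \prod_k site_factor u k w.
Proof.
rewrite /path_weight /site_factor -/(path_edges u).
elim: (path_edges u) => [|e s IHs].
  by rewrite big_nil big1// => k _; rewrite big_nil.
have eN : (minn e.1 e.2 < N)%N by rewrite gtn_min ltn_ord.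
rewrite big_cons IHs [RHS](bigD1 (Ordinal eN)) //= big_cons eqxx.
rewrite (bigD1 (Ordinal eN)) //= mulrA; congr (_ * _).
by apply: eq_bigr => k; rewrite -val_eqE /= big_cons eq_sym => /negbTE ->.
Qed.

Lemma adapted_site_factor u k :
  adapted V (window (pred1 (val k))) (site_factor u k).
Proof.
apply: adapted_prod => e /eqP ek; rewrite -[val k]/(nat_of_ord k) -ek.
exact: adapted_jacobi.
Qed.

Lemma site_factor_untouched u k w : ~~ touches u k -> site_factor u k w = 1.
Proof. by move=> uk; rewrite /site_factor big_hasC. Qed.

Lemma touches_within m u k : admissible_paths m u -> touches u k ->
  within m k u.1.
Proof.
case: u => i s [/= pis _ sm] /hasP[[x y] /= xy /eqP kE].
have [xs ys] := mem_zip xy; have {}ys : y \in i :: s by rewrite inE ys orbT.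
have kis : k \in i :: s.
  have [xy'|yx] := leqP x y.
    by have -> : k = x by apply: val_inj; rewrite /= -kE; lia.
  by have -> : k = y by apply: val_inj; rewrite /= -kE; lia.
by have := path_within pis kis; rewrite /within /= => /andP[? ?]; lia.
Qed.

Lemma measurable_mdiff k X : (k < N)%N -> measurable_fun setT (mdiff N a b k.+1 X).
Proof.
move=> kN; rewrite /mdiff /= !filtration_sites//; last exact: ltnW.
by apply: measurable_funB; exact: measurable_condexp.
Qed.

Hypothesis indep : mutually_independent V.

Notation xi u := (fun w => path_weight (jacobi N a b w) u).

(** A path of length at most [m] stays within [m] of its starting point, so any
    two sites that it touches are within [2 m] of each other. *)
Lemma path_martingale_decomposition m u : admissible_paths m u ->
  integrable1 P (xi u) -> exists D : 'I_N -> T -> R,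
  [/\ forall k : 'I_N,
        adapted V (window (fun i => (k <= i + m.*2)%N && (i <= k)%N)) (D k),
      forall k w, ~~ within m k u.1 -> D k w = 0,
      as_eq P (fun w => \sum_k D k w) (fun w => xi u w - mean P (xi u)),
      forall (k : 'I_N) Y, adapted V (window (fun i => (i < k)%N)) Y ->
        integrable1 P (fun w => Y w * D k w) ->
        mean P (fun w => Y w * D k w) = 0
    & forall k : 'I_N, as_eq P (mdiff N a b k.+1 (xi u)) (D k)].
Proof.
move=> mu ixi; have xiE : xi u = (fun w => \prod_k site_factor u k w).
  by apply/funext => w; exact: path_weight_sites.
have span i j : touches u i -> touches u j -> (i <= j + m.*2)%N.
  move=> /(touches_within mu) + /(touches_within mu); rewrite /within.
  by move=> /andP[? ?] /andP[? ?]; lia.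
have ixi' : integrable1 P (fun w => \prod_k site_factor u k w) by rewrite -xiE.
have [D [D1 D2 D3 D4 D5]] := martingale_decomposition indep
  (@adapted_site_factor u) (@site_factor_untouched u) span ixi'.
rewrite -xiE in D3 D5; exists D; split => //.
- by move=> k w uk; apply: D2; apply: contra uk; exact: touches_within.
- by apply: filterS D3 => w ->; rewrite path_weight_sites.
- by move=> k; have := D5 k; rewrite /mdiff /= !filtration_sites// ltnW.
Qed.

End JacobiPaths.

(** * Linear eigenvalue statistics as sums of locally dependent variables *)

Section OneMatrix.
Context {d : measure_display} {T : measurableType d} {R : realType}.
Context {P : probability T R}.
Variables (n : nat) (a b : nat -> {RV P >-> R}).
Notation N := n.+1.
Notation V := (@entries _ _ _ P N a b).
Notation window Q := (sites (@entry_site n) Q).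
Notation xi u := (fun w => path_weight (jacobi N a b w) u).
Hypothesis indep : mutually_independent V.
Variables (m : nat) (p : {poly R}) (v K0 : R).
Hypothesis deg_p : size p = m.+1.
Hypothesis v_gt0 : 0 < v.
Hypothesis K0_ge0 : 0 <= K0.
Hypothesis ixi : forall u, admissible_paths m u -> integrable1 P (xi u).
Hypothesis moment4 : forall u k, admissible_paths m u -> (0 < k <= N)%N ->
  ((v ^+ 4)%:E * 'E_P[fun w => (mdiff N a b k (xi u) w ^+ 4)%R] <= K0%:E)%E.

Let S w := \tr (horner_mx (jacobi N a b w) p).

Definition coef_bound : R := \sum_(r < size p) p`_r ^+ 4.

Let coef_le r : p`_r ^+ 4 <= coef_bound.
Proof.
have c0 (i : 'I_(size p)) : 0 <= p`_i ^+ 4 by rewrite exprn_even_ge0.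
have [rp|pr] := ltnP r (size p).
  by rewrite /coef_bound (bigD1 (Ordinal rp)) //= lerDl sumr_ge0.
by rewrite nth_default// expr0n /= sumr_ge0.
Qed.

Let coef_bound_ge0 : 0 <= coef_bound.
Proof. by apply: le_trans (coef_le 0); rewrite exprn_even_ge0. Qed.

(** The contribution of one path to the martingale difference at [k], scaled by
    [v] and by the coefficient of the polynomial. Paths that are not admissible
    get the value [0], to have a family indexed by all paths. *)
Let path_difference u : exists G : 'I_N -> T -> R,
  [/\ forall k : 'I_N,
        adapted V (window (fun i => (k <= i + m.*2)%N && (i <= k)%N)) (G k),
      forall k w, ~~ within m k u.1 -> G k w = 0,
      forall (k : 'I_N) Y, adapted V (window (fun i => (i < k)%N)) Y ->
        integrable1 P (fun w => Y w * G k w) -> mean P (fun w => Y w * G k w) = 0,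
      forall k, integrable4 P (G k) /\ mean P (fun w => G k w ^+ 4) <= coef_bound * K0
    & admissible_paths m u -> as_eq P (fun w => \sum_k G k w)
        (fun w => v * p`_(size u.2) * (xi u w - mean P (xi u)))].
Proof.
have [mu|nmu] := pselect (admissible_paths m u); last first.
  exists (fun _ _ => 0); split => //.
  - by move=> k; exact: adapted_cst.
  - by move=> k Y _ _; under eq_fun do rewrite mulr0; rewrite mean_cst.
  - move=> k; have -> : (fun _ : T => (0 : R) ^+ 4) = (fun=> 0).
      by apply/funext => w; rewrite expr0n.
    rewrite mean_cst mulr_ge0//; split=> //; split; first exact: measurable_cst.
    by apply: integrable1_ext (integrable1_cst P 0) => w; rewrite expr0n.
have [D [D1 D2 D3 D4 D5]] := path_martingale_decomposition indep mu (ixi mu).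
set c := v * p`_(size u.2).
have D4le (k : 'I_N) : (\int[P]_w (D k w ^+ 4)%:E <= (K0 / v ^+ 4)%:E)%E.
  have mD := adapted_measurable (@D1 k).
  have mM : measurable_fun setT (mdiff N a b k.+1 (xi u)) by exact: measurable_mdiff.
  have kN : (0 < k.+1 <= N)%N by rewrite ltnS /=.
  have := moment4 mu kN; rewrite unlock.
  rewrite (ge0_ae_eq_integral (g := fun w => (D k w ^+ 4)%:E)) //.
  - rewrite (_ : (K0 / v ^+ 4)%:E = ((v ^+ 4)^-1%:E * K0%:E)%E); last first.
      by rewrite -EFinM mulrC.
    by rewrite lee_pdivlMl // exprn_gt0.
  - by apply/measurable_EFinP; exact: measurable_funX.
  - by apply/measurable_EFinP; exact: measurable_funX.
  - by move=> w _; rewrite lee_fin exprn_even_ge0.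
  - by move=> w _; rewrite lee_fin exprn_even_ge0.
  - by apply: filterS (D5 k) => w -> _.
have iD k : integrable4 P (D k).
  split; first exact: adapted_measurable (@D1 k).
  apply/integrableP; split.
    by apply/measurable_EFinP/measurable_funX; exact: adapted_measurable (@D1 k).
  rewrite (eq_integral (fun w => (D k w ^+ 4)%:E)); last first.
    by move=> w _; rewrite /= ger0_norm// exprn_even_ge0.
  exact: le_lt_trans (D4le k) (ltry _).
exists (fun k w => c * D k w); split.
- by move=> k; apply: adaptedM; [exact: adapted_cst|exact: D1].
- by move=> k w uk; rewrite D2// mulr0.
- move=> k Y aY.
  have -> : (fun w => Y w * (c * D k w)) = (fun w => c * (Y w * D k w)).
    by apply/funext => w; rewrite mulrCA.
  move=> iY.
  have [->|c0] := eqVneq c 0; first by under eq_fun do rewrite mul0r; rewrite mean_cst.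
  have iYD : integrable1 P (fun w => Y w * D k w).
    by apply: integrable1_ext (integrable1Z c^-1 iY) => w; rewrite mulKf.
  by rewrite meanZ// D4// mulr0.
- move=> k; split; first exact: integrable4Z.
  under eq_fun do rewrite exprMn; rewrite meanZ; last exact: (iD k).2.
  have D4m : mean P (fun w => D k w ^+ 4) <= K0 / v ^+ 4.
    rewrite meanE /Rintegral -lee_fin fineK ?D4le//.
    exact: integrable_fin_num (iD k).2.
  apply: (@le_trans _ _ (c ^+ 4 * (K0 / v ^+ 4))).
    by rewrite ler_wpM2l// exprn_even_ge0.
  have -> : c ^+ 4 * (K0 / v ^+ 4) = p`_(size u.2) ^+ 4 * K0.
    by rewrite /c; field; rewrite gt_eqF.
  by rewrite ler_wpM2r.
- by move=> _; apply: filterS D3 => w; rewrite -mulr_sumr => ->.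
Qed.

(** Bounds the number of closed paths that start within [m] of a given site:
    [2 m + 1] starting points, [m + 1] lengths and at most three choices for each
    step. *)
Definition path_count : nat := m.*2.+1 * (m.+1 * 3 ^ m.+1).

Let paths_from (s : seq 'I_N) : seq ('I_N * seq 'I_N) :=
  [seq (i, t) | i <- s, t <- closed_paths (size p) i].

Let size_paths_from k : (size (paths_from (enum (within m k))) <= path_count)%N.
Proof.
rewrite size_allpairs_dep sumnE big_map.
apply: (@leq_trans (\sum_(i <- enum (within m k)) m.+1 * 3 ^ m.+1)%N).
  by apply: leq_sum => i _; rewrite deg_p; exact: size_closed_paths.
rewrite big_const_seq count_predT iter_addn_0 mulnC leq_mul2r size_within.
by rewrite orbT.
Qed.

Let paths_from_admissible s u : u \in paths_from s -> admissible_paths m u.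
Proof.
by move=> /allpairsPdep[i [t [_ + ->]]]; rewrite deg_p => /mem_closed_paths.
Qed.

Let S_paths w : S w = \sum_(u <- paths_from (enum 'I_N)) p`_(size u.2) * xi u w.
Proof.
rewrite /S (@trace_horner_paths _ _ _ (@jacobi_tridiag _ _ _ _ _ _ _ w)).
by rewrite big_allpairs_dep big_enum.
Qed.

Let S_sum : S = (fun w =>
  \sum_(u <- paths_from (enum 'I_N) | u \in paths_from (enum 'I_N))
    p`_(size u.2) * xi u w).
Proof. by apply/funext => w; rewrite S_paths big_seq. Qed.

Lemma integrable1_trace : integrable1 P S.
Proof.
rewrite S_sum; apply: integrable1_sum => u /paths_from_admissible /ixi.
exact: integrable1Z.
Qed.

Let mean_S : mean P S =
  \sum_(u <- paths_from (enum 'I_N)) p`_(size u.2) * mean P (xi u).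
Proof.
rewrite S_sum mean_sum; last by move=> u /paths_from_admissible /ixi; exact: integrable1Z.
rewrite [RHS]big_seq; apply: eq_bigr => u /paths_from_admissible /ixi.
exact: meanZ.
Qed.

(** The summands are the martingale differences of the trace, up to almost sure
    equality. Each is a sum over a number of paths bounded independently of the
    size of the matrix, hence the bound on fourth moments, and involves only the
    entries of boundedly many consecutive sites, hence the local dependence;
    orthogonality is the martingale property. *)
Theorem trace_locally_dependent : exists X : 'I_N -> T -> R,
  [/\ locally_dependent P m.*2 X,
      forall k, mean P (fun w => X k w ^+ 4) <=
        path_count%:R ^+ 4 * (coef_bound * K0)
    & as_eq P (fun w => \sum_k X k w) (fun w => v * (S w - mean P S))].
Proof.
have [G_ GP] := choice path_difference.
pose X k w := \sum_(u <- paths_from (enum 'I_N)) G_ u k w.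
have XE k : X k = (fun w => \sum_(u <- paths_from (enum (within m k))) G_ u k w).
  apply/funext => w; rewrite /X !big_allpairs_dep !big_enum /=.
  rewrite (bigID (within m k)) /= [X in _ + X]big1 ?addr0// => i ki.
  by apply: big1 => t _; have [_ G0 _ _ _] := GP (i, t); exact: G0.
have aX (k : 'I_N) :
    adapted V (window (fun i => (k <= i + m.*2)%N && (i <= k)%N)) (X k).
  by apply: adapted_sum => u _; have [+ _ _ _ _] := GP u; exact.
have X4 k : integrable4 P (X k).
  by apply: integrable4_sum => u _; have [_ _ _ /(_ k)[]] := GP u.
have X2 k := integrable4_integrable2 (X4 k).
have orth (k : 'I_N) Y : adapted V (window (fun i => (i < k)%N)) Y ->
    integrable2 P Y -> mean P (fun w => Y w * X k w) = 0.
  move=> aY Y2; have iYG u : integrable1 P (fun w => Y w * G_ u k w).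
    have [_ _ _ /(_ k)[G4 _] _] := GP u.
    exact: integrable1M Y2 (integrable4_integrable2 G4).
  under eq_fun do rewrite mulr_sumr.
  rewrite mean_sum// big1// => u _.
  by have [_ _ + _ _] := GP u; apply.
have window_sub (Q Q' : pred nat) Y : (forall i, Q i -> Q' i) ->
    adapted V (window Q) Y -> adapted V (window Q') Y.
  by move=> QQ'; apply: adaptedS; exact: sitesS.
exists X; split.
- split => //.
  + move=> k; have := orth k (fun=> 1) (adapted_cst 1) (integrable2_cst P 1).
    by under eq_fun do rewrite mul1r.
  + have lt_orth (k j : 'I_N) : (k < j)%N -> mean P (fun w => X k w * X j w) = 0.
      move=> kj; apply: orth (X2 k); apply: window_sub (@aX k) => i /andP[_ ik].
      exact: leq_ltn_trans kj.
    move=> k j; rewrite -val_eqE neq_ltn => /orP[/lt_orth//|/lt_orth jk].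
    by rewrite -jk; apply: mean_ext => w; rewrite mulrC.
  + move=> k; apply: (adapted_sites_independent indep (site := @entry_site n)
      (Q' := fun i => ~~ ((k <= i + m.*2)%N && (i <= k)%N)) _ (@aX k)).
      by move=> i ->.
    apply: adapted_sum => j; rewrite /within => kj.
    apply: window_sub (@aX j) => i /andP[ji ij]; move: kj; lia.
  + have aQ (k : 'I_N) : adapted V
        (window (fun i => (k <= i + 2 * m.*2)%N && (i <= k + m.*2)%N))
        (fun w => X k w * \sum_(i | within m.*2 k i) X i w).
      apply: adaptedM.
        by apply: window_sub (@aX k) => i /andP[ki ik]; lia.
      apply: adapted_sum => j; rewrite /within => /andP[kj jk].
      by apply: window_sub (@aX j) => i /andP[ji ij]; lia.
    move=> k j; rewrite /within => kj.
    apply: (adapted_sites_independent indep _ (@aQ k) (@aQ j)) => i /andP[ki ik].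
    by move: kj; lia.
- move=> k; rewrite XE; apply: mean_exp4_sum => //.
  + exact: mulr_ge0.
  + by move=> u; have [_ _ _ /(_ k)[]] := GP u.
  + by move=> u; have [_ _ _ /(_ k)[]] := GP u.
apply: (as_eq_trans (Y := fun w => \sum_(u <- paths_from (enum 'I_N))
    v * p`_(size u.2) * (xi u w - mean P (xi u)))).
  have G_sum u : u \in paths_from (enum 'I_N) -> as_eq P (fun w => \sum_k G_ u k w)
      (fun w => v * p`_(size u.2) * (xi u w - mean P (xi u))).
    by move=> /paths_from_admissible; have [_ _ _ _] := GP u.
  have : as_eq P (fun w => \sum_(u <- paths_from (enum 'I_N)) \sum_k G_ u k w)
      (fun w => \sum_(u <- paths_from (enum 'I_N))
        v * p`_(size u.2) * (xi u w - mean P (xi u))).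
    exact: as_eq_sum.
  by apply: filterS => w <-; rewrite exchange_big.
apply: aeW => w; rewrite mean_S S_paths -sumrB mulr_sumr.
by apply: eq_bigr => u _; ring.
Qed.

End OneMatrix.

(** * Gaussian limit of linear eigenvalue statistics *)

Lemma cvg_harmonic_powR (R : realType) (delta : R) : 0 < delta ->
  (n.+1%:R * (n.+1%:R `^ (1 + delta))^-1 : R) @[n --> \oo] --> 0.
Proof.
move=> d0.
have -> : (fun n : nat => n.+1%:R * (n.+1%:R `^ (1 + delta))^-1 : R) =
    (fun n => (harmonic n) `^ delta).
  apply/funext => n; rewrite /harmonic /=.
  have n0 : (n.+1%:R : R) != 0 by rewrite pnatr_eq0.
  rewrite powRD ?n0 ?implybT// powRr1// invfM mulrA mulfV// mul1r.
  by rewrite -[in RHS]powR_inv1 ?ler0n// -powRrM mulN1r powRN.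
have h0 : forall n : nat, 0 < harmonic n :> R by move=> n; rewrite /harmonic /= invr_gt0 ltr0n.
exact: ((cvg_at_rightP _ _ _).1 (powR_cvg0 d0) _ (conj h0 (@cvg_harmonic R))).
Qed.

Lemma prob_as_eq (d : measure_display) (T : measurableType d) (R : realType)
    (P : probability T R) (X Y : T -> R) (B : set R) :
  measurable_fun setT X -> measurable_fun setT Y -> measurable B ->
  as_eq P X Y -> P (X @^-1` B) = P (Y @^-1` B).
Proof.
move=> mX mY mB XY.
have mset (Z : T -> R) : measurable_fun setT Z -> measurable (Z @^-1` B).
  by move=> mZ; have := mZ measurableT B mB; rewrite setTI.
rewrite -(setIT (X @^-1` B)) -(setIT (Y @^-1` B)) -!integral_indic//; try exact: mset.
apply: ge0_ae_eq_integral => //.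
- by apply/measurable_EFinP; apply: measurable_indic; exact: mset.
- by apply/measurable_EFinP; apply: measurable_indic; exact: mset.
- apply: filterS XY => w XYw _ /=; rewrite !indicE.
  suff -> : (w \in X @^-1` B) = (w \in Y @^-1` B) by [].
  by apply/idP/idP; rewrite !inE /= XYw.
Qed.

(* The sequences are indexed by n with matrix size n.+1, i.e. by the positive
   integers. *)
Theorem theorem3p4 (R : realType) (m : nat) (p : {poly R})
  (deg_p : size p = m.+1)
  (d : nat -> measure_display) (T : forall n, measurableType (d n))
  (P : forall n, probability (T n) R)
  (a b : forall n, nat -> {RV (P n) >-> R})
  (b_gt0 : forall n i, (i < n)%N -> {ae P n, forall w, 0 < b n i w})
  (indep : forall n, mutually_independent (@entries _ _ _ (P n) n.+1 (a n) (b n)))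
  (J := fun n (w : T n) => jacobi n.+1 (a n) (b n) w)
  (xi := fun n u (w : T n) => path_weight (J n w) u)
  (Delta := fun n k X => mdiff n.+1 (a n) (b n) k X)
  (S := fun n (w : T n) => \tr (horner_mx (J n w) p))
  (xi_integrable : forall n u, admissible_paths m u ->
     (P n).-integrable setT (EFin \o xi n u))
  (v : nat -> R) (v_gt0 : forall n, 0 < v n)
  (sigma2 : R) (sigma2_ge0 : 0 <= sigma2)
  (var_cvg : ((v n ^+ 2)%:E * 'V_(P n)[S n])%E @[n --> \oo] --> sigma2%:E)
  (C delta : R) (C_gt0 : 0 < C) (delta_gt0 : 0 < delta)
  (moment4 : forall n u k, admissible_paths m u -> (0 < k <= n.+1)%N ->
     ((v n ^+ 4)%:E * 'E_(P n)[fun w => (Delta n k (xi n u) w ^+ 4)%R]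
        <= (C / (n.+1%:R `^ (1 + delta)))%:E)%E) :
  cvg_in_distribution P (fun n w => v n * (S n w - fine 'E_(P n)[S n]))
    (centered_gaussian sigma2).
Proof.
pose K0 n := C / (n.+1%:R `^ (1 + delta)).
have K0_ge0 n : 0 <= K0 n by rewrite divr_ge0 ?powR_ge0// ltW.
have dec n := trace_locally_dependent (indep n) deg_p (v_gt0 n) (K0_ge0 n)
  (@xi_integrable n) (@moment4 n).
pose X n := projT1 (cid (dec n)).
have XP n := projT2 (cid (dec n)).
have iS n : integrable1 (P n) (S n).
  exact: (@integrable1_trace _ _ _ (P n) n (a n) (b n) m p deg_p (@xi_integrable n)).
have X2 n : integrable2 (P n) (fun w => \sum_k X n k w).
  have [dep _ _] := XP n; apply: integrable2_sum => k _.
  exact: integrable4_integrable2 (locdep_integrable4 dep k).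
have mvS n : measurable_fun setT (fun w => v n * (S n w - fine 'E_(P n)[S n])).
  apply: measurable_funM => //; apply: measurable_funB => //.
  exact: integrable1_measurable (iS n).
pose kappa n := (path_count m)%:R ^+ 4 * (coef_bound p * K0 n).
have kappa_ge0 n : 0 <= kappa n.
  have c0 : 0 <= coef_bound p by apply: sumr_ge0 => i _; rewrite exprn_even_ge0.
  exact: mulr_ge0 (exprn_ge0 _ (ler0n _ _)) (mulr_ge0 c0 (K0_ge0 n)).
have kappa_cvg : n.+1%:R * kappa n @[n --> \oo] --> 0.
  have -> : (fun n => n.+1%:R * kappa n) = (fun n =>
      ((path_count m)%:R ^+ 4 * coef_bound p * C) *
      (n.+1%:R * (n.+1%:R `^ (1 + delta))^-1)).
    by apply/funext => n; rewrite /kappa /K0; ring.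
  rewrite -[X in _ --> X](mulr0 ((path_count m)%:R ^+ 4 * coef_bound p * C)).
  by apply: cvgM; [exact: cvg_cst|exact: cvg_harmonic_powR].
(* The martingale differences add up to the centered trace, so the second moment
   of their sum is the scaled variance. *)
have varE n : ((v n ^+ 2)%:E * 'V_(P n)[S n])%E =
    (mean (P n) (fun w => (\sum_k X n k w) ^+ 2))%:E.
  pose c := fine 'E_(P n)[S n]; have iX2 := (X2 n).2.
  have XS : as_eq (P n) (fun w => \sum_k X n k w) (fun w => v n * (S n w - c)).
    by have [] := XP n.
  rewrite meanE /Rintegral fineK; last exact: integrable_fin_num iX2.
  have mS := integrable1_measurable (iS n).
  rewrite /variance covariance.unlock.
  rewrite -/c expectation.unlock.
  have mSc : measurable_fun setT (fun w => ((S n w - c) * (S n w - c))%:E).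
    by apply/measurable_EFinP; apply: measurable_funM; apply: measurable_funB.
  rewrite -ge0_integralZl_EFin//; last 2 first.
  - by move=> w _; rewrite lee_fin /= -expr2 sqr_ge0.
  - by rewrite sqr_ge0.
  apply: ge0_ae_eq_integral => //.
  - exact: measurable_funeM.
  - by apply/measurable_EFinP; apply: measurable_funX; exact: (X2 n).1.
  - by move=> w _; rewrite -EFinM lee_fin mulr_ge0 ?sqr_ge0// -expr2 sqr_ge0.
  - by move=> w _; rewrite lee_fin sqr_ge0.
  apply: filterS XS => w XSw _ /=; rewrite -EFinM; congr EFin.
  by rewrite XSw -[LHS]/(v n ^+ 2 * ((S n w - c) * (S n w - c))); ring.
have V_cvg : mean (P n) (fun w => (\sum_k X n k w) ^+ 2) @[n --> \oo] --> sigma2.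
  have := var_cvg; under eq_fun do rewrite varE.
  by move=> /fine_cvg.
have clt := clt_locally_dependent kappa_ge0 (fun n => let: And3 h _ _ := XP n in h)
  (fun n => let: And3 _ h _ := XP n in h) sigma2_ge0 V_cvg kappa_cvg.
move=> x cx; have := clt x cx.
have -> // : (fun n => P n ((fun w => \sum_k X n k w) @^-1` `]-oo, x])) =
  (fun n => P n ((fun w => v n * (S n w - fine 'E_(P n)[S n])) @^-1` `]-oo, x])).
apply/funext => n; apply: prob_as_eq => //; first exact: (X2 n).1.
by have [_ _] := XP n.
Qed.
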